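(* Suppose that the Basic Assumptions (a)-(c) hold with constants $f_{\mathrm{low}}$, $L_1>0$, $\sigma>0$, $\alpha\in(1,2]$, and that the Weakly Average Smoothness Assumption holds with $L>0$. Define $$\widetilde{M}_\alpha := 2\big(f(x^0) - f_{\mathrm{low}} + \sigma^\alpha + L_1/2\big),$$ $$\widehat{M}_\alpha := 2\big(2^{1/(\alpha-1)}(\alpha-1)(2/\alpha)^{\alpha/(\alpha-1)}+ 12(L_1^\alpha+L^\alpha) + 12\sigma^\alpha\big).$$ Let $\{x^k\}$ be generated by the normalized SFOM with recursive momentum with input parameters $$\eta_k= \theta_k=\frac{1}{(k+1)^{2/3}}\qquad\forall k\ge0.$$ Then, for any $\epsilon \in (0,1)$, it holds that $\mathbb{E}[\|\nabla f(x^{\iota_K})\|]\le \epsilon$ for all integers $K$ satisfying $$K\ge\max\Big\{\Big(\frac{12\widetilde{M}_\alpha}{\epsilon}\ln\Big(\frac{12\widetilde{M}_{\alpha}}{\epsilon}\Big)\Big)^{3},\Big(\frac{6\alpha\widehat{M}_\alpha}{(\alpha-1)\epsilon}\ln\Big(\frac{6\alpha \widehat{M}_\alpha}{(\alpha-1)\epsilon}\Big)\Big)^{3\alpha/(2(\alpha-1))},3\Big\},$$ where $\iota_K$ is uniformly drawn from $\{0,\ldots,K-1\}$.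
   Context: Setting. $\|\cdot\|$ is the Euclidean norm on $\mathbb{R}^n$. The function $f:\mathbb{R}^n\to\mathbb{R}$ is continuously differentiable and the problem $\min_{x\in\mathbb{R}^n} f(x)$ has at least one optimal solution. $\xi$ is a random variable with sample space $\Xi$, and $G:\mathbb{R}^n\times\Xi\to\mathbb{R}^n$ is a stochastic gradient estimator. Basic Assumptions. (a) There is a finite $f_{\mathrm{low}}$ with $f(x)\ge f_{\mathrm{low}}$ for all $x\in\mathbb{R}^n$. (b) There is $L_1>0$ with $\|\nabla f(x)-\nabla f(y)\|\le L_1\|x-y\|$ for all $x,y\in\mathbb{R}^n$. (c) $\mathbb{E}[G(x;\xi)]=\nabla f(x)$ and $\mathbb{E}[\|G(x;\xi)-\nabla f(x)\|^\alpha]\le\sigma^\alpha$ for all $x\in\mathbb{R}^n$, for some $\sigma>0$ and $\alpha\in(1,2]$. Weakly Average Smoothness Assumption. There is $L>0$ such that $\mathbb{E}[\|G(x;\xi)-G(y;\xi)\|^\alpha]\le L^\alpha\|x-y\|^\alpha$ for all $x,y\in\mathbb{R}^n$, with the same $\alpha$ as in (c). Normalized SFOM with recursive momentum. Input: a starting point $x^0\in\mathbb{R}^n$, step sizes $\{\eta_k\}_{k\ge0}\subset(0,+\infty)$, weights $\{\theta_k\}_{k\ge0}\subset(0,1]$. Initialize $x^{-1}=x^0$, $m^{-1}=0$, $\theta_{-1}=1$. For $k=0,1,2,\ldots$: $m^k=(1-\theta_{k-1})m^{k-1}+G(x^k;\xi^k)-(1-\theta_{k-1})G(x^{k-1};\xi^k)$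 and $x^{k+1}=x^k-\eta_k m^k/\|m^k\|$, where $\{\xi^k\}$ is a sequence of independently drawn samples of $\xi$. The iteration is understood to be well defined, i.e. $m^k\ne0$ for all $k$. The index $\iota_K$ is drawn independently of the algorithm's samples, so $\mathbb{E}[\|\nabla f(x^{\iota_K})\|]=\frac1K\sum_{k=0}^{K-1}\mathbb{E}[\|\nabla f(x^k)\|]$. *)

(* Defs.v *)
From HB Require Import structures.
From mathcomp Require Import all_boot all_order all_algebra.
From mathcomp Require Import finmap.
From mathcomp Require Import all_classical all_reals all_analysis.

Set Implicit Arguments.
Unset Strict Implicit.
Unset Printing Implicit Defensive.

Import Order.TTheory GRing.Theory Num.Def Num.Theory.
Import numFieldNormedType.Exports.

Local Open Scope classical_set_scope.
Local Open Scope ring_scope.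

(* The library norm on 'rV[R]_n is the sup norm; it is used below only through
   the topology it induces (differentiability, continuity). *)
Definition enorm (R : realType) (n : nat) (v : 'rV[R]_n) : R :=
  Num.sqrt (\sum_(i < n) v 0 i ^+ 2).

Definition gradient (R : realType) (n : nat) (f : 'rV[R]_n -> R)
    (x : 'rV[R]_n) : 'rV[R]_n :=
  \row_(i < n) 'D_(delta_mx 0 i) f x.

Definition continuously_differentiable (R : realType) (n : nat)
    (f : 'rV[R]_n -> R) : Prop :=
  (forall x, differentiable f x) /\ continuous (gradient f).

(* R^n carries its Borel sigma-algebra, which is the product sigma-algebra of
   the measurable type n.-tuple R. *)
Definition jointly_measurable (R : realType) (n : nat) (d : measure_display)
    (Xi : measurableType d) (G : 'rV[R]_n -> Xi -> 'rV[R]_n) : Prop :=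
  forall i : 'I_n, measurable_fun [set: n.-tuple R * Xi]
    (fun p => G (\row_(j < n) tnth p.1 j) p.2 0 i).

(* Requiring the extended-real expectation of Y i to be a real number forces
   Y i to be integrable when it is measurable: an undefined expectation
   evaluates to -oo. *)
Definition has_vector_mean (R : realType) (n : nat) (d : measure_display)
    (Xi : measurableType d) (mu : probability Xi R)
    (Y : Xi -> 'rV[R]_n) (v : 'rV[R]_n) : Prop :=
  forall i : 'I_n, ('E_mu[fun z => Y z ord0 i] = (v ord0 i)%:E)%E.

Definition mutually_independent (R : realType) (d d' : measure_display)
    (Omega : measurableType d) (Xi : measurableType d')
    (P : probability Omega R) (xi : nat -> {RV P >-> Xi}) : Prop :=
  forall (J : {fset nat}) (B : nat -> set Xi), (forall k, measurable (B k)) ->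
    (P (\bigcap_(k in [set` J]) (xi k @^-1` B k)) =
     \prod_(k <- J) P (xi k @^-1` B k))%E.

Definition sigma_of_sequence (R : realType) (d d' : measure_display)
    (Omega : measurableType d) (Xi : measurableType d')
    (P : probability Omega R) (xi : nat -> {RV P >-> Xi}) : set (set Omega) :=
  <<s \bigcup_k preimage_set_system setT (xi k) measurable >>.

Definition independent_of_sequence (R : realType) (d d' : measure_display)
    (Omega : measurableType d) (Xi : measurableType d')
    (P : probability Omega R) (iotaK : {RV P >-> nat})
    (xi : nat -> {RV P >-> Xi}) : Prop :=
  forall (A : set nat) (C : set Omega), sigma_of_sequence xi C ->
    (P ((iotaK @^-1` A) `&` C) = P (iotaK @^-1` A) * P C)%E.

Definition uniform_below (R : realType) (d : measure_display)
    (Omega : measurableType d) (P : probability Omega R) (K : nat)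
    (iotaK : {RV P >-> nat}) : Prop :=
  forall k : nat, (k < K)%N ->
    distribution P iotaK [set k] = ((K%:R : R)^-1)%:E.

(* theta_{k-1}, with theta_{-1} = 1 *)
Definition theta_prev (R : realType) (theta : nat -> R) (k : nat) : R :=
  if k is k'.+1 then theta k' else 1.

(* rm_state k = (x^{k-1}, x^k, m^{k-1}), with x^{-1} = x^0 and m^{-1} = 0 *)
Fixpoint rm_state (R : realType) (n : nat) (Xi : Type)
    (G : 'rV[R]_n -> Xi -> 'rV[R]_n) (x0 : 'rV[R]_n) (eta theta : nat -> R)
    (xi : nat -> Xi) (k : nat) : 'rV[R]_n * 'rV[R]_n * 'rV[R]_n :=
  if k is k'.+1 then
    let: (xp, x, mp) := rm_state G x0 eta theta xi k' in
    let m := (1 - theta_prev theta k') *: mp + G x (xi k')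
             - (1 - theta_prev theta k') *: G xp (xi k') in
    (x, x - (eta k' / enorm m) *: m, m)
  else (x0, x0, 0).

Definition rm_iterate (R : realType) (n : nat) (Xi : Type)
    (G : 'rV[R]_n -> Xi -> 'rV[R]_n) (x0 : 'rV[R]_n) (eta theta : nat -> R)
    (xi : nat -> Xi) (k : nat) : 'rV[R]_n :=
  (rm_state G x0 eta theta xi k).1.2.

(* m^k is produced by the k-th step, hence stored in the state of index k+1. *)
Definition rm_momentum (R : realType) (n : nat) (Xi : Type)
    (G : 'rV[R]_n -> Xi -> 'rV[R]_n) (x0 : 'rV[R]_n) (eta theta : nat -> R)
    (xi : nat -> Xi) (k : nat) : 'rV[R]_n :=
  (rm_state G x0 eta theta xi k.+1).2.

Definition M_tilde (R : realType) (fx0 f_low sigma alpha L1 : R) : R :=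
  2 * (fx0 - f_low + sigma `^ alpha + L1 / 2).

Definition M_hat (R : realType) (alpha L1 L sigma : R) : R :=
  2 * (2 `^ (alpha - 1)^-1 * (alpha - 1)
         * (2 / alpha) `^ (alpha / (alpha - 1))
       + 12 * (L1 `^ alpha + L `^ alpha) + 12 * sigma `^ alpha).

(* Main.v *)
Require Import Defs.
From HB Require Import structures.
From mathcomp Require Import all_boot all_order all_algebra.
From mathcomp Require Import finmap.
From mathcomp Require Import all_classical all_reals all_analysis.
From mathcomp Require Import measurable_realfun.
From mathcomp Require Import ring lra.

Set Implicit Arguments.
Unset Strict Implicit.
Unset Printing Implicit Defensive.

Import Order.TTheory GRing.Theory Num.Def Num.Theory.
Import numFieldNormedType.Exports.

Local Open Scope classical_set_scope.
Local Open Scope ring_scope.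

(** Why the bound holds.  Write e^k := m^k - grad f (x^k) for the momentum error
    and follow the potential
      E[f (x^k) - f_low] + p_k E[|e^k|^alpha],
    where p_k = (k + 1)^weight_exp.

    A normalized step has length at most eta_k, so the descent lemma gives
    f (x^(k+1)) <= f (x^k) - eta_k |grad f (x^k)| + 2 eta_k |e^k| + L1 eta_k^2 / 2
    (normalized_step_descent).  For 1 < alpha <= 2 the power |.|^alpha has the
    first-order expansion |a + b|^alpha <= |a|^alpha + c <a, b> + 2 |b|^alpha
    (enorm_powR_expansion).  Apply it with a = (1 - theta_k) e^k, known before the
    next sample is drawn, and b the centered part of the update: the linear term
    averages out, and the moment of b is of order eta_k^alpha + theta_k^alpha by
    the smoothness of grad f and of the estimator and by the noise bound.
    Hence E[|e^k|^alpha] contracts by 1 - theta_k up to a term of that order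
    (momentum_error_step, mean_error_step).

    Young's inequality bounds 2 eta_k |e^k| by (p_k theta_k / 2) |e^k|^alpha plus
    a multiple of (k + 1)^(- decay_exp); its first part is absorbed since
    p_(k+1) (1 - theta_k) + p_k theta_k / 2 <= p_k (weight_contraction).  The
    exponent of p_k is the one for which this remainder and the weighted noise
    p_(k+1) eta_k^alpha are of equal order.  The potential then telescopes
    (sum_mean_gradient), the remainders sum to at most a constant times
    K^(1 - decay_exp) (1 + ln K), and dividing by K eta_(K-1) = K^(1/3) bounds
    the averaged gradient norm by a sum of two terms M ln K / K^g (average_le).
    For u = K^g, the condition 2 y ln (2 y) <= u implies ln u <= u / y
    (ln_le_div), and so each of the two terms is at most eps / 2 (log_rate_le).

    On the probability side, x^k and m^(k-1) are measurable for the
    sigma-algebra of the first k samples (vmeasurable_rm_state), which is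
    independent of the next one (past_independent).  By Tonelli's theorem the
    sample can then be integrated first, with the state frozen (indep_integral).
    The independent index iotaK is integrated out in the same way
    (integral_uniform_index). *)

(** * Inequalities for real powers and logarithms *)

Section power_inequalities.
Context {R : realType}.
Implicit Types p q r t u x : R.

(** Tangent line at 1 of the convex function x `^ p, read off Young's inequality
    for the product x * 1. *)
Lemma bernoulli_powR_ge p x : 1 < p -> 0 <= x -> 1 + p * (x - 1) <= x `^ p.
Proof.
move=> p1 x0; have p0 : 0 < p by lra.
have q0 : 0 < p / (p - 1) by rewrite divr_gt0//; lra.
have pq : p^-1 + (p / (p - 1))^-1 = 1.
  by field; apply/andP; split; apply/eqP; lra.
have := conjugate_powR x0 (@ler01 R) p0 q0 pq.
rewrite mulr1 powR1 div1r -(ler_pM2l p0) mulrDr mulrCA divff ?gt_eqF// mulr1.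
rewrite (_ : p / (p / (p - 1)) = p - 1); last first.
  by field; apply/andP; split; apply/eqP; lra.
lra.
Qed.

(** The convex bound applied to x `^ p with exponent p^-1. *)
Lemma bernoulli_powR_le p x : 0 < p -> p <= 1 -> 0 <= x ->
  x `^ p <= 1 + p * (x - 1).
Proof.
move=> p0; rewrite le_eqVlt => /predU1P[->|p1] x0; first by rewrite powRr1//; lra.
have p1' : 1 < p^-1 by rewrite invf_gt1.
have := bernoulli_powR_ge p1' (powR_ge0 x p).
rewrite -powRrM mulfV ?gt_eqF// powRr1// -(ler_pM2l p0) mulrDr mulrA.
rewrite mulfV ?gt_eqF//; lra.
Qed.

(** Summing the tangent-line bounds at the mean of a, b, c gives the constant
    3 `^ (p - 1), which is at most 3. *)
Lemma powR_sum3_le p a b c : 1 < p -> p <= 2 -> 0 <= a -> 0 <= b -> 0 <= c ->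
  (a + b + c) `^ p <= 3 * (a `^ p + b `^ p + c `^ p).
Proof.
move=> p1 p2 a0 b0 c0; set m := (a + b + c) / 3.
have abcE : a + b + c = 3 * m by rewrite /m; field.
have m0 : 0 <= m by rewrite divr_ge0// !addr_ge0.
have [/eqP mz|mn0] := boolP (m == 0).
  rewrite abcE mz mulr0 powR0 ?gt_eqF//; last lra.
  by rewrite mulr_ge0// !addr_ge0 ?powR_ge0.
have mp : 0 < m by rewrite lt_neqAle eq_sym mn0.
have T x : 0 <= x -> m `^ p * (1 + p * (x / m - 1)) <= x `^ p.
  move=> x0; have -> : x `^ p = m `^ p * (x / m) `^ p.
    by rewrite -powRM//; [rewrite mulrC divfK|rewrite divr_ge0].
  by rewrite ler_wpM2l ?powR_ge0// bernoulli_powR_ge// divr_ge0.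
have H : 3 * m `^ p <= a `^ p + b `^ p + c `^ p.
  apply: le_trans (lerD (lerD (T a a0) (T b b0)) (T c c0)).
  rewrite -!mulrDr mulrC ler_wpM2l ?powR_ge0//.
  have : a / m + b / m + c / m = 3 by rewrite -!mulrDl abcE mulfK.
  by move=> E; rewrite -subr_ge0; nra.
rewrite abcE powRM//; apply: le_trans (ler_wpM2l _ H) => //.
rewrite mulrA ler_wpM2r ?powR_ge0//.
have -> : 3 * 3 = 3 `^ 2%:R :> R by rewrite powR_mulrn// expr2.
by rewrite ler_powR//; lra.
Qed.

(** Here u stands for an inner product <a, b> with |a| = 1 and |b| = t.  For
    t <= 1 Bernoulli's inequality leaves a remainder of order t ^+ 2, at most
    t `^ al; for t > 1 the factor t ^+ 2 is taken out before Bernoulli's inequality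
    is used, and the linear term in u is then compared at the worst sign. *)
Lemma unit_norm_power_expansion al t u : 1 < al -> al <= 2 -> 0 <= t ->
  `|u| <= t ->
  (1 + 2 * u + t ^+ 2) `^ (al / 2) <= 1 + al * u + 2 * t `^ al.
Proof.
move=> al1 al2 t0; rewrite ler_norml => /andP[ut tu].
have s0 : 0 <= 1 + 2 * u + t ^+ 2 by have := sqr_ge0 (1 - t); nra.
have h0 : 0 < al / 2 by lra.
have h1 : al / 2 <= 1 by lra.
have [t1|t1] := lerP t 1.
  apply: le_trans (bernoulli_powR_le h0 h1 s0) _.
  have : t ^+ 2 <= t `^ al.
    have [->|tn0] := eqVneq t 0; first by rewrite expr2 mul0r powR_ge0.
    by rewrite -powR_mulrn// ger_powR// lt_neqAle eq_sym tn0 t0.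
  have := sqr_ge0 t; nra.
have tp : 0 < t by lra.
have t2p : 0 < t ^+ 2 by rewrite exprn_gt0.
have -> : 1 + 2 * u + t ^+ 2 = t ^+ 2 * (1 + (1 + 2 * u) / t ^+ 2).
  by field; rewrite gt_eqF.
have w0 : 0 <= 1 + (1 + 2 * u) / t ^+ 2.
  rewrite (_ : 1 + _ = (1 + 2 * u + t ^+ 2) / t ^+ 2).
    by rewrite divr_ge0 ?(ltW t2p).
  by field; rewrite gt_eqF.
rewrite powRM ?(ltW t2p)// -(powR_mulrn 2 t0) -powRrM.
rewrite (_ : 2%:R * (al / 2) = al); last by field.
apply: le_trans (ler_wpM2l (powR_ge0 _ _) (bernoulli_powR_le h0 h1 _)) _.
  by rewrite powR_mulrn.
rewrite powR_mulrn//.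
(* everything is expressed by A = t `^ (al - 1): t `^ al = t * A and
   t `^ al / t ^+ 2 = A / t, with 1 <= A <= t *)
set A := t `^ (al - 1).
have EA : t `^ al = t * A by rewrite /A mulr_powRB1//; lra.
have A1 : 1 <= A by rewrite -(powRr0 t) ler_powR//; lra.
have At : A <= t by rewrite -[leRHS]powRr1// ler_powR//; lra.
have B : 1 + al * (t - 1) <= t * A by rewrite -EA bernoulli_powR_ge.
rewrite EA; set L := (X in X <= _).
have -> : L = t * A + al / 2 * (A / t) + al * u * (A / t).
  by rewrite /L; field; rewrite gt_eqF.
have At1 : A / t <= 1 by rewrite ler_pdivrMr// mul1r.
have At0 : 0 <= A / t by rewrite divr_ge0// (le_trans _ A1).
have EAt : A / t * t = A by rewrite divfK// gt_eqF.
have : - (al * u * (1 - A / t)) <= al * (t - A).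
  rewrite -{2}EAt (_ : t - A / t * t = t * (1 - A / t)); last ring.
  rewrite -mulNr mulrA ler_wpM2r ?subr_ge0//; nra.
nra.
Qed.

(** The case r = 1 by homogeneity. *)
Lemma norm_power_expansion al r t u : 1 < al -> al <= 2 -> 0 < r -> 0 <= t ->
  `|u| <= r * t ->
  (r ^+ 2 + 2 * u + t ^+ 2) `^ (al / 2)
    <= r `^ al + al * (r `^ al / r ^+ 2) * u + 2 * t `^ al.
Proof.
move=> al1 al2 r0 t0 urt.
have r2 : 0 < r ^+ 2 by rewrite exprn_gt0.
have tr0 : 0 <= t / r by rewrite divr_ge0// ltW.
have ut : `|u / r ^+ 2| <= t / r.
  rewrite normrM normfV (gtr0_norm r2) ler_pdivrMr// mulrC.
  by rewrite (_ : _ * (_ / _) = r * t)//; field; rewrite gt_eqF.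
have E : r `^ al = (r ^+ 2) `^ (al / 2).
  by rewrite -powR_mulrn ?(ltW r0)// -powRrM; congr (_ `^ _); field.
have s0 : 0 <= 1 + 2 * (u / r ^+ 2) + (t / r) ^+ 2.
  have := sqr_ge0 (1 - t / r).
  by move: ut; rewrite ler_norml => /andP[? ?]; nra.
have -> : r ^+ 2 + 2 * u + t ^+ 2
          = r ^+ 2 * (1 + 2 * (u / r ^+ 2) + (t / r) ^+ 2).
  by field; rewrite gt_eqF.
rewrite powRM ?(ltW r2)// -E.
apply: le_trans (ler_wpM2l (powR_ge0 _ _)
  (unit_norm_power_expansion al1 al2 tr0 ut)) _.
have -> : t `^ al = r `^ al * (t / r) `^ al.
  by rewrite -powRM ?(ltW r0)// mulrC divfK// gt_eqF.
by rewrite le_eqVlt; apply/predU1P; left; ring.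
Qed.

(** The constant is the maximum of 2 * s - s `^ al / 2 over s >= 0.  It comes out
    of Young's inequality for the product of c * s and 2 / c, where c is chosen to
    make the first Young term equal to s `^ al / 2. *)
Lemma young_constant al s : 1 < al -> 0 <= s ->
  2 * s <= s `^ al / 2 + (2 : R) `^ (al - 1)^-1 * (al - 1)
         * (2 / al) `^ (al / (al - 1)).
Proof.
move=> al1 s0; set be := al / (al - 1).
have al0 : 0 < al by lra.
have am : 0 < al - 1 by lra.
have be0 : 0 < be by rewrite divr_gt0.
have pq : al^-1 + be^-1 = 1.
  by rewrite /be; field; apply/andP; split; apply/eqP; lra.
set c := (al / 2) `^ al^-1.
have c0 : 0 < c by rewrite powR_gt0// divr_gt0.
have h : 0 <= 2 / c by rewrite divr_ge0// ltW.
have := conjugate_powR (mulr_ge0 (ltW c0) s0) h al0 be0 pq.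
rewrite (_ : c * s * (2 / c) = 2 * s); last by field; rewrite gt_eqF.
rewrite powRM ?(ltW c0)// /c -powRrM mulVf ?gt_eqF// powRr1 ?divr_ge0 ?(ltW al0)//.
rewrite (_ : al / 2 * _ / al = s `^ al / 2); last by field; rewrite gt_eqF.
move=> /le_trans; apply; rewrite lerD2l le_eqVlt; apply/predU1P; left.
rewrite -/c.
(* be = 1 + 1 / (al - 1), and (2 / c)^be = 2^be (2 / al)^(1 / (al - 1)) *)
have Ebe : be = 1 + (al - 1)^-1 by rewrite /be; field; rewrite gt_eqF.
have cE : (2 / c) `^ be = 2 `^ be * (2 / al) `^ (al - 1)^-1.
  rewrite powRM ?invr_ge0 ?(ltW c0)//; congr (_ * _).
  rewrite -powR_inv1 ?(ltW c0)// /c -!powRrM.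
  rewrite -[2 / al]invf_div -[in RHS]powR_inv1 ?divr_ge0 ?(ltW al0)// -powRrM.
  by congr (_ `^ _); rewrite /be; field; rewrite !gt_eqF.
rewrite cE.
have D x : 0 < x -> x `^ be = x * x `^ (al - 1)^-1.
  by move=> x0; rewrite Ebe powRD ?(gt_eqF x0) ?implybT// powRr1 ?(ltW x0).
rewrite !D//; last by rewrite divr_gt0.
by rewrite /be; field; rewrite !gt_eqF.
Qed.

(** Concavity of ln at 2 * y gives ln x <= x / (2 * y) + ln (2 * y) - 1, and the
    hypothesis bounds ln (2 * y) by x / (2 * y). *)
Lemma ln_le_div x y : 0 < x -> 0 < y -> 2 * y * ln (2 * y) <= x -> ln x <= x / y.
Proof.
move=> x0 y0 h; have y2 : 0 < 2 * y by rewrite mulr_gt0.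
have xy : 0 < x / (2 * y) by rewrite divr_gt0.
have : ln (x / (2 * y)) <= x / (2 * y) - 1.
  by rewrite -[in leLHS](subrKC 1 (x / (2 * y))) le_ln1Dx//; lra.
rewrite ln_div ?posrE//.
have : ln (2 * y) <= x / (2 * y) by rewrite ler_pdivlMr// mulrC.
have -> : x / y = x / (2 * y) + x / (2 * y) by field; rewrite gt_eqF.
lra.
Qed.

(** That is e <= 3, from e ^ (- 1/6) >= 5/6 and (6/5) ^ 6 < 3. *)
Lemma ln_ge1 (x : R) : 3 <= x -> 1 <= ln x.
Proof.
move=> x3; rewrite -ler_expR lnK ?posrE; last lra.
apply: le_trans x3.
have : 1 - 1/6 <= expR (- (1/6)) :> R by have := expR_ge1Dx (- (1/6) : R); lra.
rewrite expRN => h; have e0 := expR_gt0 (1/6 : R).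
have {h} : expR (1/6) <= 6/5 :> R.
  have := ler_wpM2r (ltW e0) h; rewrite mulVf ?gt_eqF//; lra.
move=> h; rewrite (_ : 1 = 6%:R * (1/6) :> R); last by field.
rewrite expRM_natl; apply: (@le_trans _ _ ((6/5) ^+ 6)).
  by rewrite lerXn2r ?nnegrE ?(ltW e0)//; lra.
by rewrite !exprS expr0; lra.
Qed.

End power_inequalities.

(** * The Euclidean norm *)

Section euclidean_space.
Context {R : realType} {n : nat}.
Implicit Types a b c d x y m : 'rV[R]_n.

Definition dotv a b : R := \sum_(i < n) a 0 i * b 0 i.

Lemma enorm_ge0 a : 0 <= enorm a. Proof. exact: sqrtr_ge0. Qed.

Lemma sqr_enorm a : enorm a ^+ 2 = dotv a a.
Proof.
by rewrite /enorm sqr_sqrtr// sumr_ge0// => i _; rewrite sqr_ge0.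
Qed.

Lemma dotvDr a b c : dotv a (b + c) = dotv a b + dotv a c.
Proof. by rewrite /dotv -big_split; apply: eq_bigr => i _; rewrite mxE mulrDr. Qed.

Lemma dotvZr a k b : dotv a (k *: b) = k * dotv a b.
Proof. by rewrite /dotv big_distrr; apply: eq_bigr => i _; rewrite mxE mulrCA. Qed.

Lemma dotvC a b : dotv a b = dotv b a.
Proof. by apply: eq_bigr => i _; rewrite mulrC. Qed.

Lemma dotvDl a b c : dotv (a + b) c = dotv a c + dotv b c.
Proof. by rewrite !(dotvC _ c) dotvDr. Qed.

Lemma dotvZl k a b : dotv (k *: a) b = k * dotv a b.
Proof. by rewrite !(dotvC _ b) dotvZr. Qed.

Lemma dotvBl a b c : dotv (a - b) c = dotv a c - dotv b c.
Proof. by rewrite dotvDl -scaleN1r dotvZl mulN1r. Qed.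

Lemma dotv0l a : dotv 0 a = 0.
Proof. by rewrite /dotv big1// => i _; rewrite mxE mul0r. Qed.

Lemma enorm0 : enorm (0 : 'rV[R]_n) = 0.
Proof. by apply/eqP; rewrite -sqrf_eq0 sqr_enorm dotv0l. Qed.

Lemma enorm_eq0 a : (enorm a == 0) = (a == 0).
Proof.
apply/idP/idP => [|/eqP ->]; last by rewrite enorm0.
rewrite -sqrf_eq0 sqr_enorm /dotv psumr_eq0; last first.
  by move=> i _; rewrite -expr2 sqr_ge0.
move=> /allP a0; apply/eqP/rowP => i; rewrite mxE.
by have := a0 i (mem_index_enum _); rewrite implyTb -expr2 sqrf_eq0 => /eqP.
Qed.

Lemma enormZ k a : enorm (k *: a) = `|k| * enorm a.
Proof.
apply/eqP; rewrite -(@eqrXn2 _ 2)//; last 2 first.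
- exact: enorm_ge0.
- by rewrite mulr_ge0// enorm_ge0.
by rewrite exprMn !sqr_enorm dotvZl dotvZr mulrA -expr2 real_normK// num_real.
Qed.

Lemma enormN a : enorm (- a) = enorm a.
Proof. by rewrite -scaleN1r enormZ normrN1 mul1r. Qed.

Lemma sqr_enormD a b :
  enorm (a + b) ^+ 2 = enorm a ^+ 2 + 2 * dotv a b + enorm b ^+ 2.
Proof. by rewrite !sqr_enorm dotvDl !dotvDr (dotvC b a); ring. Qed.

Lemma cauchy_schwarz a b : `|dotv a b| <= enorm a * enorm b.
Proof.
have le u v : dotv u v <= enorm u * enorm v.
  have [/eqP|u0] := eqVneq (enorm u) 0.
    by rewrite enorm_eq0 => /eqP ->; rewrite dotv0l mulr_ge0 ?enorm_ge0.
  have up : 0 < enorm u by rewrite lt_neqAle eq_sym u0 enorm_ge0.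
  have [/eqP|v0] := eqVneq (enorm v) 0.
    by rewrite enorm_eq0 => /eqP ->; rewrite dotvC dotv0l mulr_ge0 ?enorm_ge0.
  have vp : 0 < enorm v by rewrite lt_neqAle eq_sym v0 enorm_ge0.
  have := sqr_ge0 (enorm (enorm v *: u + (- enorm u) *: v)).
  rewrite sqr_enormD !enormZ normrN !ger0_norm ?enorm_ge0//.
  rewrite dotvZl dotvZr => h.
  have : 0 <= (enorm u * enorm v) * (enorm u * enorm v - dotv u v) by nra.
  by rewrite pmulr_rge0 ?mulr_gt0// subr_ge0.
rewrite ler_norml le andbT lerNl.
by have := le (-1 *: a) b; rewrite dotvZl mulN1r enormZ normrN1 mul1r.
Qed.

Lemma ler_enormD a b : enorm (a + b) <= enorm a + enorm b.
Proof.
rewrite -(ler_pXn2r (ltn0Sn 1)) ?nnegrE ?addr_ge0 ?enorm_ge0//.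
have := cauchy_schwarz a b; rewrite ler_norml => /andP[_] ab.
by rewrite sqr_enormD; nra.
Qed.

(** For a != 0 the coefficient c is al * enorm a `^ (al - 2), that of the
    gradient of enorm `^ al; at a = 0 the linear term vanishes whatever c. *)
Lemma enorm_powR_expansion al a : 1 < al -> al <= 2 ->
  exists c : R, forall b,
    enorm (a + b) `^ al <= enorm a `^ al + c * dotv a b + 2 * enorm b `^ al.
Proof.
move=> al1 al2; have [->|a0] := eqVneq a 0.
  exists 0 => b; rewrite add0r enorm0 powR0 ?gt_eqF//; last lra.
  by rewrite mul0r !add0r; have := powR_ge0 (enorm b) al; lra.
exists (al * (enorm a `^ al / enorm a ^+ 2)) => b.
have ap : 0 < enorm a by rewrite lt_neqAle eq_sym enorm_eq0 a0 enorm_ge0.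
apply: le_trans (norm_power_expansion al1 al2 ap (enorm_ge0 b) (cauchy_schwarz a b)).
rewrite -sqr_enormD -powR_mulrn ?enorm_ge0// -powRrM.
by rewrite (_ : 2%:R * (al / 2) = al)//; field.
Qed.

Lemma enorm_sum3_powR_le al a b c : 1 < al -> al <= 2 ->
  enorm (a + b + c) `^ al
    <= 3 * (enorm a `^ al + enorm b `^ al + enorm c `^ al).
Proof.
move=> al1 al2.
apply: le_trans (powR_sum3_le al1 al2 (enorm_ge0 a) (enorm_ge0 b) (enorm_ge0 c)).
rewrite ge0_ler_powR ?nnegrE ?addr_ge0 ?enorm_ge0//; first lra.
by rewrite (le_trans (ler_enormD _ _))// lerD2r ler_enormD.
Qed.

End euclidean_space.

(** * Descent along a normalized step *)

Section descent.
Context {R : realType} {n : nat} (f : 'rV[R]_n -> R).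
Hypothesis df : forall x, differentiable f x.

Lemma dotv_gradient x d : dotv (gradient f x) d = 'D_d f x.
Proof.
rewrite deriveE// {2}(row_sum_delta d) linear_sum; apply: eq_bigr => i _.
by rewrite linearZ /= mxE deriveE// mulrC.
Qed.

(** The difference quotients of f along the line are those defining the
    directional derivative. *)
Lemma is_derive_line x d (t : R) :
  is_derive t 1 (fun s : R => f (x + s *: d)) (dotv (gradient f (x + t *: d)) d).
Proof.
rewrite dotv_gradient.
have E : (fun h : R => h^-1 *: (f (x + (h *: 1 + t) *: d) - f (x + t *: d))) =
         (fun h : R => h^-1 *: (f (h *: d + (x + t *: d)) - f (x + t *: d))).
  apply/funext => h; congr (_ *: (f _ - _)).
  by rewrite scalerDl [h *: 1]mulr1 addrCA.
have D : derivable f (x + t *: d) d by exact: diff_derivable.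
by apply: DeriveDef; rewrite /derivable /derive /= E.
Qed.

(** The function g below is f on the segment from x to y minus the claimed bound
    at the same point; its derivative is nonpositive on ]0, 1[ by the Lipschitz
    condition, so the mean value theorem gives g 1 <= g 0. *)
Lemma descent_lemma (L : R) x y :
  (forall u v, enorm (gradient f u - gradient f v) <= L * enorm (u - v)) ->
  f y <= f x + dotv (gradient f x) (y - x) + L / 2 * enorm (y - x) ^+ 2.
Proof.
move=> lip; set d := y - x; set N := enorm d ^+ 2.
set c := dotv (gradient f x) d.
pose g (t : R) := f (x + t *: d) - (t * c + t ^+ 2 * (L / 2 * N)).
have dg (t : R) : is_derive t 1 g
    (dotv (gradient f (x + t *: d)) d - (c + t * (L * N))).
  have h := is_derive_line x d t.
  rewrite /g; apply: is_derive_eq.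
  by rewrite /GRing.scale /=; field.
have cg : {within `[0, 1], continuous g}.
  apply: continuous_subspaceT => t; apply: differentiable_continuous.
  by apply/derivable1_diffP; case: (dg t).
have [t t01 gE] := MVT ltr01 (fun t _ => dg t) cg.
move: t01; rewrite in_itv/= => /andP[t0 t1].
have : g 1 - g 0 <= 0.
  rewrite gE subr0 mulr1 opprD addrA.
  have -> : dotv (gradient f (x + t *: d)) d - c
            = dotv (gradient f (x + t *: d) - gradient f x) d.
    by rewrite dotvBl.
  rewrite subr_le0; apply: le_trans (ler_norm _) _.
  apply: le_trans (cauchy_schwarz _ _) _.
  apply: le_trans (ler_wpM2r (enorm_ge0 _) (lip _ _)) _.
  rewrite addrC addKr enormZ gtr0_norm// /N expr2.
  by rewrite le_eqVlt; apply/predU1P; left; ring.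
rewrite /g !scale1r !scale0r addr0 (_ : x + d = y); last by rewrite /d addrC subrK.
rewrite !mul1r expr1n mul1r mul0r expr0n mul0r addr0 subr0; lra.
Qed.

(** The inner product of gradient f x with m / enorm m is at least
    enorm m - enorm (m - gradient f x), and enorm m is itself at least
    enorm (gradient f x) - enorm (m - gradient f x): hence the factor 2.  For m = 0
    the iterate does not move, and the error is enorm (gradient f x). *)
Lemma normalized_step_descent (L eta : R) x m :
  (forall u v, enorm (gradient f u - gradient f v) <= L * enorm (u - v)) ->
  0 <= L -> 0 <= eta ->
  f (x - (eta / enorm m) *: m) + eta * enorm (gradient f x)
    <= f x + 2 * eta * enorm (m - gradient f x) + L / 2 * eta ^+ 2.
Proof.
move=> lip L0 e0; set g := gradient f x.
have [->|m0] := eqVneq m 0.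
  rewrite sub0r enormN scaler0 subr0.
  have := sqr_ge0 eta; have := enorm_ge0 g; nra.
set e := m - g.
have mp : 0 < enorm m by rewrite lt_neqAle eq_sym enorm_eq0 m0 enorm_ge0.
have := descent_lemma x (x - (eta / enorm m) *: m) lip.
rewrite (addrAC x) subrr sub0r enormN enormZ ger0_norm ?divr_ge0 ?(ltW mp)//.
rewrite divfK ?gt_eqF//.
rewrite -scaleNr dotvZr.
have gm : dotv (gradient f x) m = enorm m ^+ 2 - dotv e m.
  by rewrite sqr_enorm /e dotvBl -/g; ring.
rewrite gm mulNr mulrBr.
have -> : eta / enorm m * enorm m ^+ 2 = eta * enorm m.
  by field; rewrite gt_eqF.
have : eta / enorm m * dotv e m <= eta * enorm e.
  have := cauchy_schwarz e m; rewrite ler_norml => /andP[_] em.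
  rewrite -mulrA ler_wpM2l// mulrC ler_pdivrMr//.
have : enorm g <= enorm m + enorm e.
  by rewrite -(enormN e); apply: le_trans (ler_enormD _ _); rewrite /e opprB addrC subrK.
rewrite -/g; nra.
Qed.

Lemma normalized_step_length (eta : R) (x m : 'rV[R]_n) : 0 <= eta ->
  enorm ((x - (eta / enorm m) *: m) - x) <= eta.
Proof.
move=> e0; rewrite addrAC subrr sub0r enormN enormZ.
have [->|m0] := eqVneq m 0; first by rewrite enorm0 mulr0.
have mp : 0 < enorm m by rewrite lt_neqAle eq_sym enorm_eq0 m0 enorm_ge0.
by rewrite ger0_norm ?divr_ge0 ?(ltW mp)// divfK ?gt_eqF.
Qed.

End descent.

(** * Measurability of vectors and of the iterates *)

Section vector_measurability.
Context {R : realType} {n : nat} {d : measure_display} {T : measurableType d}.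
Implicit Types X Y : T -> 'rV[R]_n.

(** Borel measurability of a random vector, tested on its coordinates, so that
    the algebra of measurable real functions applies. *)
Definition vmeasurable X := forall i, measurable_fun setT (fun w => X w 0 i).

Lemma vmeasurable_cst (v : 'rV[R]_n) : vmeasurable (fun=> v).
Proof. by move=> i; exact: measurable_cst. Qed.

Lemma vmeasurableD X Y :
  vmeasurable X -> vmeasurable Y -> vmeasurable (fun w => X w + Y w).
Proof.
move=> mX mY i; rewrite (_ : (fun _ => _) = (fun w => X w 0 i + Y w 0 i)).
  exact: measurable_funD.
by apply/funext => w; rewrite mxE.
Qed.

Lemma vmeasurableZ (k : T -> R) X :
  measurable_fun setT k -> vmeasurable X -> vmeasurable (fun w => k w *: X w).
Proof.
move=> mk mX i; rewrite (_ : (fun _ => _) = (fun w => k w * X w 0 i)).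
  exact: measurable_funM.
by apply/funext => w; rewrite mxE.
Qed.

Lemma vmeasurableB X Y :
  vmeasurable X -> vmeasurable Y -> vmeasurable (fun w => X w - Y w).
Proof.
move=> mX mY i; rewrite (_ : (fun _ => _) = (fun w => X w 0 i - Y w 0 i)).
  exact: measurable_funB.
by apply/funext => w; rewrite !mxE.
Qed.

Lemma measurable_enorm X : vmeasurable X ->
  measurable_fun setT (fun w => enorm (X w)).
Proof.
move=> mX; apply: (@measurableT_comp _ _ _ _ _ _ (Num.sqrt : R -> R)) => /=.
  by apply: continuous_measurable_fun; exact: sqrt_continuous.
apply: measurable_sum => i; exact: measurable_funX.
Qed.

Lemma measurable_enorm_powR X (p : R) : vmeasurable X ->
  measurable_fun setT (fun w => enorm (X w) `^ p).
Proof.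
move=> mX; apply: (@measurableT_comp _ _ _ _ _ _ (@powR R ^~ p)) => //=.
exact: measurable_enorm.
Qed.

(** An open set of vectors is a countable union of balls with rational center
    and radius 1 / k, each of which is a finite intersection of conditions on
    single coordinates. *)
Lemma vmeasurable_open X (V : set 'rV[R]_n) :
  vmeasurable X -> open V -> measurable (X @^-1` V).
Proof.
move=> mX oV.
pose q2r (q : 'rV[rat]_n) : 'rV[R]_n := map_mx ratr q.
pose B (p : 'rV[rat]_n * nat) : set 'rV[R]_n := ball (q2r p.1) (p.2.+1%:R^-1).
pose F p := X @^-1` (if `[< B p `<=` V >] then B p else set0).
have -> : X @^-1` V = \bigcup_p F p.
  apply/seteqP; split => w /=; last first.
    by move=> [p _]; rewrite /F /=; case: asboolP => // BV /BV.
  move=> Vw; move: (oV); rewrite openE => /(_ _ Vw) /nbhs_ballP[e /= e0 eV].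
  have [k ke] : exists k : nat, 2 / k.+1%:R < e.
    exists (Num.truncn (2 / e)); rewrite ltr_pdivrMr// mulrC -ltr_pdivrMr//.
    exact: truncnS_gt.
  have k0 : (0 : R) < k.+1%:R^-1 by rewrite invr_gt0.
  have /choice[q qP] (i : 'I_n) : exists q : rat,
      ratr q \in `](X w 0 i - k.+1%:R^-1), (X w 0 i + k.+1%:R^-1)[.
    by apply: rat_in_itvoo; rewrite ltrD2l gtrN.
  have Bw : B (\row_i q i, k) (X w).
    split => // i j; rewrite !mxE /ball/= ord1.
    by have := qP j; rewrite in_itv/= -ltr_distlC distrC.
  exists (\row_i q i, k) => //; rewrite /F /=; case: asboolP => //; apply.
  move=> v Bv; apply: eV.
  have /ball_sym Bw' := Bw.
  have := ball_triangle Bw' Bv; apply: le_ball.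
  by rewrite (le_trans _ (ltW ke))//= mulr_natl mulr2n.
apply: countable_bigcupT_measurable => [|p]; first exact: countableP.
rewrite /F; case: asboolP => _; last by rewrite preimage_set0.
have -> : X @^-1` B p = \bigcap_(i in [set: 'I_n])
    ((fun w => X w 0 i) @^-1` (ball (q2r p.1 0 i) (p.2.+1%:R^-1))).
  apply/seteqP; split => w /=; first by move=> [_ h] i _; exact: h.
  by move=> h; split => [|i j]; rewrite ?ord1; [rewrite invr_gt0|exact: h].
apply: fin_bigcap_measurable => // i _.
rewrite -[X in measurable X]setTI; apply: mX => //.
exact: measurable_ball.
Qed.

Lemma measurable_continuous_comp (f : 'rV[R]_n -> R) X :
  continuous f -> vmeasurable X -> measurable_fun setT (fun w => f (X w)).
Proof.
move=> cf mX; apply: (measurability _ (RGenOpens.measurableE R)).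
move=> _ [_ [a [b ->] <-]]; rewrite setTI.
apply: (@vmeasurable_open X (f @^-1` `]a, b[%classic)) => //.
by move/continuousP : cf; apply; exact: interval_open.
Qed.

Lemma vmeasurable_continuous_comp (g : 'rV[R]_n -> 'rV[R]_n) X :
  continuous g -> vmeasurable X -> vmeasurable (fun w => g (X w)).
Proof.
move=> cg mX i; apply: (measurable_continuous_comp (f := fun x => g x 0 i)) => //.
move=> x; apply: (@continuous_comp _ _ _ g (fun M : 'rV[R]_n => M 0 i)).
  exact: cg.
exact: coord_continuous.
Qed.

Lemma vmeasurable_comp d' (T' : measurableType d') (phi : T' -> T) X :
  measurable_fun setT phi -> vmeasurable X ->
  forall i, measurable_fun setT (fun w => X (phi w) 0 i).
Proof. by move=> mphi mX i; exact: (measurableT_comp (mX i) mphi). Qed.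

Lemma vmeasurable_joint_comp dXi (Xi : measurableType dXi)
    (G : 'rV[R]_n -> Xi -> 'rV[R]_n) X (Z : T -> Xi) :
  jointly_measurable G -> vmeasurable X -> measurable_fun setT Z ->
  vmeasurable (fun w => G (X w) (Z w)).
Proof.
move=> mG mX mZ i.
pose tX w : n.-tuple R := [tuple X w 0 j | j < n].
have mtX : measurable_fun setT tX.
  apply/measurable_fun_tnthP => j.
  rewrite (_ : _ \o _ = fun w => X w 0 j)//.
  by apply/funext => w /=; rewrite tnth_mktuple.
have := measurableT_comp (mG i) (measurable_fun_pair mtX mZ).
rewrite (_ : _ \o _ = fun w => G (X w) (Z w) 0 i)//.
apply/funext => w /=; congr (G _ _ _ _); apply/rowP => j.
by rewrite mxE tnth_mktuple.
Qed.

End vector_measurability.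

Section algorithm.
Context {R : realType} {n : nat} {Xi : Type} (G : 'rV[R]_n -> Xi -> 'rV[R]_n)
  (x0 : 'rV[R]_n) (eta theta : nat -> R).

Lemma rm_momentumE (zeta : nat -> Xi) k :
  let S := rm_state G x0 eta theta zeta k in
  let t := theta_prev theta k in
  rm_momentum G x0 eta theta zeta k
  = (1 - t) *: S.2 + G S.1.2 (zeta k) - (1 - t) *: G S.1.1 (zeta k).
Proof. by rewrite /rm_momentum /=; case: rm_state => [[]]. Qed.

Lemma rm_stateS (zeta : nat -> Xi) k :
  let x := rm_iterate G x0 eta theta zeta k in
  let m := rm_momentum G x0 eta theta zeta k in
  rm_state G x0 eta theta zeta k.+1 = (x, x - (eta k / enorm m) *: m, m).
Proof. by rewrite /rm_momentum /rm_iterate /=; case: rm_state => [[]]. Qed.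

Lemma rm_iterateS (zeta : nat -> Xi) k :
  let x := rm_iterate G x0 eta theta zeta k in
  let m := rm_momentum G x0 eta theta zeta k in
  rm_iterate G x0 eta theta zeta k.+1 = x - (eta k / enorm m) *: m.
Proof. by move=> x m; rewrite [LHS]/rm_iterate rm_stateS. Qed.

End algorithm.

Section algorithm_measurability.
Context {R : realType} {n : nat} {dXi : measure_display}
  {Xi : measurableType dXi} (G : 'rV[R]_n -> Xi -> 'rV[R]_n)
  (x0 : 'rV[R]_n) (eta theta : nat -> R).
Hypothesis mG : jointly_measurable G.
Context {d : measure_display} {T : measurableType d} (zeta : nat -> T -> Xi).

Let S k w := rm_state G x0 eta theta (fun j => zeta j w) k.

(** Only the first k samples enter, so the lemma applies with T the
    sigma-algebra that they generate. *)
Lemma vmeasurable_rm_state k :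
  (forall j, (j < k)%N -> measurable_fun setT (zeta j)) ->
  [/\ vmeasurable (fun w => (S k w).1.1), vmeasurable (fun w => (S k w).1.2)
    & vmeasurable (fun w => (S k w).2)].
Proof.
elim: k => [|k IHk] mz; first by split; exact: vmeasurable_cst.
have [j jk|m1 m2 m3] := IHk; first by apply: mz; exact: ltnW.
have mk := mz k (ltnSn k).
have mm : vmeasurable (fun w => rm_momentum G x0 eta theta (fun j => zeta j w) k).
  under eq_fun do rewrite rm_momentumE.
  apply: vmeasurableB.
    apply: vmeasurableD; last exact: vmeasurable_joint_comp.
    exact: vmeasurableZ.
  by apply: vmeasurableZ => //; exact: vmeasurable_joint_comp.
rewrite /S; under [X in vmeasurable X]eq_fun do rewrite rm_stateS.
split => //.
under eq_fun do rewrite rm_stateS /=.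
apply: vmeasurableB => //; apply: vmeasurableZ => //.
apply: measurable_funM => //.
(* x^-1 = x `^ (-1) on nonnegative reals, also at 0 *)
under eq_fun do rewrite -powR_inv1 ?enorm_ge0//.
exact: measurable_enorm_powR.
Qed.

End algorithm_measurability.

(** * Independence and iterated integration *)

Section independence.
Local Open Scope ereal_scope.
Context {R : realType} {d : measure_display} {Omega : measurableType d}
  (P : probability Omega R).

(** The joint law of S and Y is the product of their laws, so Tonelli's theorem
    lets Y be integrated first, with S frozen. *)
Lemma indep_integral d1 d2 (T : measurableType d1) (Z : measurableType d2)
    (S : Omega -> T) (Y : Omega -> Z) (nu : probability Z R)
    (h : T * Z -> \bar R) :
  measurable_fun setT S -> measurable_fun setT Y ->
  (forall A B, measurable A -> measurable B ->
    P (S @^-1` A `&` Y @^-1` B) = P (S @^-1` A) * nu B) ->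
  measurable_fun setT h -> (forall x, 0 <= h x) ->
  \int[P]_w h (S w, Y w) = \int[P]_w \int[nu]_z h (S w, z).
Proof.
move=> mS mY ind mh h0.
pose S' : {mfun Omega >-> T} := HB.pack S (isMeasurableFun.Build _ _ _ _ _ mS).
pose SY : {mfun Omega >-> (T * Z)%type} := HB.pack (fun w => (S w, Y w))
  (isMeasurableFun.Build _ _ _ _ _ (measurable_fun_pair mS mY)).
transitivity (\int[distribution P SY]_x h x).
  by rewrite ge0_integral_distribution.
transitivity (\int[(distribution P S' \x nu)]_x h x).
  apply: eq_measure_integral => A mA _; apply/esym.
  by apply: product_measure_unique.
rewrite fubini_tonelli1//.
rewrite ge0_integral_distribution//; last by move=> y; exact: integral_ge0.
exact: measurable_fun_fubini_tonelli_F.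
Qed.

Lemma indep_integral_le d1 d2 (T : measurableType d1) (Z : measurableType d2)
    (S : Omega -> T) (Y : Omega -> Z) (nu : probability Z R)
    (h : T * Z -> \bar R) (g : Omega -> \bar R) :
  measurable_fun setT S -> measurable_fun setT Y ->
  (forall A B, measurable A -> measurable B ->
    P (S @^-1` A `&` Y @^-1` B) = P (S @^-1` A) * nu B) ->
  measurable_fun setT h -> (forall x, 0 <= h x) ->
  measurable_fun setT g -> (forall w, \int[nu]_z h (S w, z) <= g w) ->
  \int[P]_w h (S w, Y w) <= \int[P]_w g w.
Proof.
move=> mS mY ind mh h0 mg hg; rewrite (indep_integral mS mY ind)//.
apply: ge0_le_integral => //; first by move=> w _; exact: integral_ge0.
have mF := @measurable_fun_fubini_tonelli_F _ _ _ _ _ nu h mh h0.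
exact: (measurableT_comp mF mS).
Qed.

(** Conditioning on a sub-sigma-algebra is the case of indep_integral in which S
    is this identity map. *)
Lemma measurable_id_sub (G : set (set Omega)) : G `<=` measurable ->
  measurable_fun setT (idfun : Omega -> g_sigma_algebraType G).
Proof.
move=> GM _ A mA; rewrite setTI preimage_id.
by apply: (smallest_sub _ GM) mA; exact: sigma_algebra_measurable.
Qed.

Context {dXi : measure_display} {Xi : measurableType dXi}
  (xi : nat -> {RV P >-> Xi}).

(** Events generating the information available before sample k is drawn. *)
Definition past (k : nat) : set (set Omega) :=
  \bigcup_(j in `I_k) preimage_set_system setT (xi j) measurable.

Lemma past_measurable k : past k `<=` measurable.
Proof. by move=> A [j _ [B mB <-]]; exact: measurable_funPT. Qed.

Lemma measurable_past k j : (j < k)%N ->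
  measurable_fun setT (xi j : g_sigma_algebraType (past k) -> Xi).
Proof.
move=> jk _ A mA; apply: sub_sigma_algebra; exists j => //.
by exists A.
Qed.

(** Both sides are finite measures in C.  They agree on the pi-system D of
    cylinders over the first k samples, which generates the past. *)
Lemma past_independent : mutually_independent xi ->
  forall k C B, <<s past k >> C -> measurable B ->
  P (C `&` xi k @^-1` B) = P C * P (xi k @^-1` B).
Proof.
move=> ind k C B sC mB.
pose D : set (set Omega) :=
  [set A | exists2 F : nat -> set Xi, (forall j, measurable (F j)) &
    A = \bigcap_(j in `I_k) (xi j @^-1` F j)].
have mpre j F : measurable F -> measurable (xi j @^-1` F).
  by move=> mF; rewrite -[X in measurable X]setTI; exact: measurable_funPT.
have DM : D `<=` measurable.
  by move=> A [F mF ->]; apply: bigcap_measurableType => j _; exact: mpre.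
have pastD : past k `<=` D.
  move=> A [j jk [F mF <-]]; exists (fun i => if i == j then F else setT).
    by move=> i; case: ifPn.
  rewrite setTI; apply/seteqP; split => w /=.
    by move=> Fw i ik; case: ifPn => // /eqP ->.
  by move=> /(_ j jk); rewrite eqxx.
have {}sC : <<s D >> C.
  apply: smallest_sub sC; first exact: smallest_sigma_algebra.
  by move=> A /pastD; exact: sub_sigma_algebra.
have mY : measurable (xi k @^-1` B) by exact: mpre.
have p0 : (0 <= fine (P (xi k @^-1` B)))%R by rewrite fine_ge0.
pose m1 := mrestr P mY.
pose m2 := mscale (NngNum p0) P.
suff : m1 C = m2 C.
  rewrite /m1 /m2 /mrestr /mscale/= => ->.
  by rewrite fineK ?fin_num_measure// muleC.
apply: (g_sigma_algebra_measure_unique D DM (fun=> setT)) => //.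
- by move=> _; exists (fun=> setT) => //; apply/esym/seteqP; split.
- by apply/seteqP; split => // w _; exists 0%N.
- move=> _ _ [F mF ->] [F' mF' ->]; exists (fun j => F j `&` F' j).
    by move=> j; exact: measurableI.
  by rewrite -bigcapI.
- move=> A [F mF ->].
  change (P (\bigcap_(j in `I_k) (xi j @^-1` F j) `&` xi k @^-1` B) =
    (fine (P (xi k @^-1` B)))%:E * P (\bigcap_(j in `I_k) (xi j @^-1` F j))).
  rewrite fineK ?fin_num_measure//.
  pose F' j := if (j < k)%N then F j else B.
  have mF' j : measurable (F' j) by rewrite /F'; case: ifP.
  pose J := [fset j in iota 0 k]%fset.
  have JE j : (j \in J) = (j < k)%N by rewrite !inE /= mem_iota.
  have -> : \bigcap_(j in `I_k) (xi j @^-1` F j)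
            = \bigcap_(j in [set` J]) (xi j @^-1` F' j).
    apply: eq_bigcap; last first.
      by move=> j /=; rewrite /F'/= => ->.
    by split => j /=; rewrite JE.
  have -> : \bigcap_(j in [set` J]) (xi j @^-1` F' j) `&` xi k @^-1` B
     = \bigcap_(j in [set` (k |` J)%fset]) (xi j @^-1` F' j).
    apply/seteqP; split => w /=.
      move=> [h Bw] j /=; rewrite in_fset1U JE => /orP[/eqP ->|jk].
        by rewrite /F' ltnn.
      by apply: h => /=; rewrite JE.
    move=> h; split.
      by move=> j jk; apply: h; rewrite /= in_fset1U; apply/orP; right.
    by have := h k; rewrite /= /F' ltnn; apply; rewrite in_fset1U eqxx.
  rewrite !ind// big_fsetU1 ?JE ?ltnn//=.
  by rewrite {1}/F' ltnn.
- move=> _; change (P (setT `&` xi k @^-1` B) < +oo).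
  by rewrite (le_lt_trans (probability_le1 P _)) ?ltry//; exact: measurableI.
Qed.

End independence.

(** * The momentum error for a frozen past *)

Section finite_mean.
Context {R : realType} {d : measure_display} {T : measurableType d}
  (mu : probability T R).
Implicit Types (F : T -> R) (v : R).

(** Integrability and value of the integral in one predicate: it is stable under
    linear combinations and lets expectations be handled as real numbers. *)
Definition has_mean F v :=
  mu.-integrable setT (EFin \o F) /\ (\int[mu]_z (F z)%:E = v%:E)%E.

Lemma has_mean_cst v : has_mean (fun=> v) v.
Proof.
split; first exact: finite_measure_integrable_cst.
by rewrite integral_cst//= probability_setT mule1.
Qed.

Lemma has_meanD F1 F2 v1 v2 : has_mean F1 v1 -> has_mean F2 v2 ->
  has_mean (fun z => F1 z + F2 z) (v1 + v2).
Proof.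
move=> [i1 e1] [i2 e2]; split.
  by have := integrableD measurableT i1 i2; apply: eq_integrable.
under eq_integral do rewrite EFinD.
by rewrite integralD// e1 e2.
Qed.

Lemma has_meanZ k F v : has_mean F v -> has_mean (fun z => k * F z) (k * v).
Proof.
move=> [i1 e1]; split.
  by have := integrableZl measurableT k i1; apply: eq_integrable.
under eq_integral do rewrite EFinM.
by rewrite integralZl// e1.
Qed.


(** An integral that is a real number forces integrability. *)
Lemma has_mean_integrable F v : measurable_fun setT F ->
  (\int[mu]_z (F z)%:E = v%:E)%E -> has_mean F v.
Proof.
move=> mF Fv; split => //; apply/integrableP; split.
  exact/measurable_EFinP.
by rewrite (integral_fin_num_abs mu measurableT mF) Fv.
Qed.

Lemma has_mean_ge0_le F v : measurable_fun setT F -> (forall z, 0 <= F z) ->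
  (\int[mu]_z (F z)%:E <= v%:E)%E -> exists2 u, has_mean F u & u <= v.
Proof.
move=> mF F0 Fv.
have I0 : (0 <= \int[mu]_z (F z)%:E)%E.
  by apply: integral_ge0 => z _; rewrite lee_fin.
have Ifin : (\int[mu]_z (F z)%:E)%E \is a fin_num.
  by rewrite ge0_fin_numE// (le_lt_trans Fv)// ltry.
exists (fine (\int[mu]_z (F z)%:E)%E); last by rewrite -lee_fin fineK.
by apply: has_mean_integrable => //; rewrite fineK.
Qed.

Lemma has_mean_ge0_ub F1 F2 v : measurable_fun setT F1 ->
  (forall z, 0 <= F1 z) -> (forall z, F1 z <= F2 z) -> has_mean F2 v ->
  (\int[mu]_z (F1 z)%:E <= v%:E)%E.
Proof.
move=> mF1 F10 F12 [i2 <-]; apply: ge0_le_integral => //.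
- by move=> z _; rewrite lee_fin.
- exact/measurable_EFinP.
- exact: measurable_int i2.
- by move=> z _; rewrite lee_fin.
Qed.

End finite_mean.

Section momentum_error.
Context {R : realType} {n : nat} {d : measure_display} {Xi : measurableType d}
  (mu : probability Xi R).
Variables (G : 'rV[R]_n -> Xi -> 'rV[R]_n) (g : 'rV[R]_n -> 'rV[R]_n).
Variables (al sigma L L1 : R).
Hypothesis mG : jointly_measurable G.
Hypotheses (al1 : 1 < al) (al2 : al <= 2) (L10 : 0 <= L1).
Hypothesis lip : forall x y, enorm (g x - g y) <= L1 * enorm (x - y).
Hypothesis meanG : forall x, has_vector_mean mu (G x) (g x).
Hypothesis noise : forall x,
  (\int[mu]_z (enorm (G x z - g x) `^ al)%:E <= (sigma `^ al)%:E)%E.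
Hypothesis smooth : forall x y,
  (\int[mu]_z (enorm (G x z - G y z) `^ al)%:E
     <= (L `^ al * enorm (x - y) `^ al)%:E)%E.

Lemma vmeasurable_estimator x : vmeasurable (G x).
Proof.
exact: (vmeasurable_joint_comp mG (vmeasurable_cst x) (@measurable_id _ _ _)).
Qed.

Lemma has_mean_dotv a x : has_mean mu (fun z => dotv a (G x z)) (dotv a (g x)).
Proof.
rewrite /dotv; elim: (index_enum _) => [|i s IHs].
  under eq_fun do rewrite big_nil; rewrite big_nil; exact: has_mean_cst.
under eq_fun do rewrite big_cons; rewrite big_cons; apply: has_meanD => //.
apply: has_meanZ; apply: has_mean_integrable; first exact: vmeasurable_estimator.
by have := meanG x i; rewrite unlock.
Qed.

(** One update of the recursive momentum, for a frozen past x, y, m.  The new error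
    is a + N z, with a the contracted old error and N z centered: the linear
    term of the expansion of enorm `^ al around a averages out.  The three parts
    of N z are controlled by smooth, by lip and by noise; 6 is the 2 of
    enorm_powR_expansion times the 3 of enorm_sum3_powR_le. *)
Lemma momentum_error_step (t : R) (m x y : 'rV[R]_n) : 0 <= t -> t <= 1 ->
  (\int[mu]_z (enorm ((1 - t) *: m + G y z - (1 - t) *: G x z - g y) `^ al)%:E
    <= ((1 - t) * enorm (m - g x) `^ al
        + 6 * ((L1 `^ al + L `^ al) * enorm (y - x) `^ al
               + sigma `^ al * t `^ al))%:E)%E.
Proof.
move=> t0 t1; set D := enorm (y - x).
have al0 : 0 <= al by exact: le_trans ler01 (ltW al1).
have s0 : 0 <= 1 - t by rewrite subr_ge0.
pose a := (1 - t) *: (m - g x).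
pose N z := (1 - t) *: (G y z - G x z) + (- (1 - t)) *: (g y - g x)
            + t *: (G y z - g y).
have E z : (1 - t) *: m + G y z - (1 - t) *: G x z - g y = a + N z.
  by apply/rowP => i; rewrite /a /N !mxE; ring.
under eq_integral do rewrite E.
have mN : vmeasurable N.
  have mGx := vmeasurable_estimator x; have mGy := vmeasurable_estimator y.
  apply: vmeasurableD; first apply: vmeasurableD.
  - by apply: vmeasurableZ => //; exact: vmeasurableB.
  - exact: vmeasurable_cst.
  - by apply: vmeasurableZ => //; apply: vmeasurableB => //; exact: vmeasurable_cst.
have [c hc] := enorm_powR_expansion a al1 al2.
have lin : has_mean mu (fun z => dotv a (N z)) 0.
  have := has_meanD (has_meanD (has_mean_dotv a y)
      (has_meanZ (- (1 - t)) (has_mean_dotv a x)))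
    (has_mean_cst mu (- dotv a (g y) + (1 - t) * dotv a (g x))).
  set v := (X in has_mean _ _ X); have -> : v = 0 by rewrite /v; ring.
  congr (has_mean _ _ _); apply/funext => z; rewrite /N.
  rewrite !dotvDr !dotvZr !(dotvC a) !dotvBl; ring.
have [u [hu uB]] : exists u, has_mean mu (fun z => enorm (G y z - G x z) `^ al) u
    /\ u <= L `^ al * D `^ al.
  have := smooth y x => /has_mean_ge0_le[|z|u]; last by exists u.
    apply: measurable_enorm_powR; apply: vmeasurableB; exact: vmeasurable_estimator.
  exact: powR_ge0.
have [v [hv vB]] : exists v, has_mean mu (fun z => enorm (G y z - g y) `^ al) v
    /\ v <= sigma `^ al.
  have := noise y => /has_mean_ge0_le[|z|v]; last by exists v.
    apply: measurable_enorm_powR; apply: vmeasurableB; last exact: vmeasurable_cst.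
    exact: vmeasurable_estimator.
  exact: powR_ge0.
have Nle z : enorm (N z) `^ al <=
    3 * (enorm (G y z - G x z) `^ al + L1 `^ al * D `^ al
         + t `^ al * enorm (G y z - g y) `^ al).
  apply: le_trans (enorm_sum3_powR_le _ _ _ al1 al2) _.
  rewrite ler_pM2l// !enormZ normrN (ger0_norm t0) (ger0_norm s0).
  rewrite (powRM _ t0 (enorm_ge0 _)) lerD2r; apply: lerD.
    apply: ge0_ler_powR; rewrite ?nnegrE ?(mulr_ge0 s0) ?enorm_ge0//.
    by rewrite ler_piMl ?enorm_ge0// gerBl.
  rewrite -(powRM _ L10 (enorm_ge0 _)).
  apply: ge0_ler_powR; rewrite ?nnegrE ?(mulr_ge0 s0) ?(mulr_ge0 L10) ?enorm_ge0//.
  by apply: le_trans (lip y x); rewrite ler_piMl ?enorm_ge0// gerBl.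
have ale : enorm a `^ al <= (1 - t) * enorm (m - g x) `^ al.
  rewrite /a enormZ (ger0_norm s0).
  move: t1; rewrite le_eqVlt => /predU1P[->|t1].
    by rewrite subrr !mul0r powR0// gt_eqF// (lt_trans ltr01 al1).
  by apply: ge1r_powRZ (enorm_ge0 _) (ltW al1); rewrite subr_gt0 t1 gerBl.
have := has_meanD (has_meanD (has_mean_cst mu (enorm a `^ al)) (has_meanZ c lin))
  (has_meanZ 6 (has_meanD (has_meanD hu (has_mean_cst mu (L1 `^ al * D `^ al)))
                 (has_meanZ (t `^ al) hv))).
move=> /has_mean_ge0_ub ub; apply: le_trans (ub (fun z => enorm (a + N z) `^ al) _ _ _) _.
- apply: measurable_enorm_powR; apply: vmeasurableD => //; exact: vmeasurable_cst.
- by move=> z; exact: powR_ge0.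
- move=> z; apply: le_trans (hc _) _; rewrite lerD2l.
  by apply: le_trans (ler_wpM2l (ler0n R 2) (Nle z)) _; rewrite mulrA -natrM.
- have : t `^ al * v <= t `^ al * sigma `^ al by rewrite ler_wpM2l ?powR_ge0.
  move=> tv; rewrite lee_fin mulr0 addr0; apply: lerD; first exact: ale.
  rewrite ler_pM2l// mulrDl (mulrC (sigma `^ al)); apply: lerD; last exact: tv.
  by rewrite addrC; apply: lerD; [exact: lexx|exact: uB].
Qed.

End momentum_error.

(** * The potential in expectation *)

Section arithmetic.
Context {R : realType}.

Lemma progress_arith (F0 F1 lo e g s qs c D : R) :
  2 * e * s <= qs + c -> F1 + e * g <= F0 + 2 * e * s + D ->
  F1 - lo + e * g <= F0 - lo + (qs + (c + D)).
Proof. lra. Qed.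

Lemma telescoping_arith (s1 s2 F B p' p g g' a a' r q C e t : R) :
  s2 + (g + p * a) <= F + s1 -> g' + e * r <= g + (q * a + C) ->
  p' * a' <= p' * ((1 - t) * a + B) -> (p' * (1 - t) + q) * a <= p * a ->
  s2 + e * r + (g' + p' * a') <= F + (s1 + (C + p' * B)).
Proof. nra. Qed.

Lemma remainder_arith (C D M p E T S : R) : 0 <= T -> 0 <= S ->
  p * E <= 2 * D ->
  C * D + M + p * (6 * (T * E + S * E)) <= M + (C + 12 * T + 12 * S) * D.
Proof. by move=> T0 S0 pE; have := ler_wpM2l (addr_ge0 T0 S0) pE; nra. Qed.

End arithmetic.

Section expected_progress.
Context {R : realType} {n : nat} (f : 'rV[R]_n -> R).
Context {dXi : measure_display} {Xi : measurableType dXi} (mu : probability Xi R).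
Variables (G : 'rV[R]_n -> Xi -> 'rV[R]_n) (f_low L1 sigma al L : R).
Hypotheses (hC1 : continuously_differentiable f) (mG : jointly_measurable G).
Hypotheses (al1 : 1 < al) (al2 : al <= 2) (L10 : 0 <= L1).
Hypothesis low : forall x, f_low <= f x.
Hypothesis lip : forall x y,
  enorm (gradient f x - gradient f y) <= L1 * enorm (x - y).
Hypothesis meanG : forall x, has_vector_mean mu (G x) (gradient f x).
Hypothesis noise : forall x,
  (\int[mu]_z (enorm (G x z - gradient f x) `^ al)%:E <= (sigma `^ al)%:E)%E.
Hypothesis smooth : forall x y,
  (\int[mu]_z (enorm (G x z - G y z) `^ al)%:E
     <= (L `^ al * enorm (x - y) `^ al)%:E)%E.
Context {dOmega : measure_display} {Omega : measurableType dOmega}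
  (P : probability Omega R) (xi : nat -> {RV P >-> Xi}).
Hypothesis law : forall k B, measurable B -> distribution P (xi k) B = mu B.
Hypothesis ind : mutually_independent xi.
Variables (x0 : 'rV[R]_n) (eta theta : nat -> R).
Hypotheses (eta0 : forall k, 0 <= eta k).
Hypotheses (theta0 : forall k, 0 <= theta k) (theta1 : forall k, theta k <= 1).

Let S k w := rm_state G x0 eta theta (fun j => xi j w) k.
Let X k w := rm_iterate G x0 eta theta (fun j => xi j w) k.
Let M k w := rm_momentum G x0 eta theta (fun j => xi j w) k.
Let err k w := enorm (M k w - gradient f (X k w)) `^ al.
Let grad k w := enorm (gradient f (X k w)).
Let gap k w := f (X k w) - f_low.

Let vmS k : [/\ vmeasurable (fun w => (S k w).1.1),
  vmeasurable (fun w => (S k w).1.2) & vmeasurable (fun w => (S k w).2)].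
Proof. by apply: vmeasurable_rm_state => // j _. Qed.

Let vmX k : vmeasurable (X k). Proof. by have [] := vmS k. Qed.
Let vmM k : vmeasurable (M k). Proof. by have [] := vmS k.+1. Qed.

Let vmgrad k : vmeasurable (fun w => gradient f (X k w)).
Proof. by apply: vmeasurable_continuous_comp => //; exact: hC1.2. Qed.

Let merr k : measurable_fun setT (err k).
Proof. by apply: measurable_enorm_powR; apply: vmeasurableB. Qed.

Let mgrad k : measurable_fun setT (grad k).
Proof. exact: measurable_enorm. Qed.

Let mgap k : measurable_fun setT (gap k).
Proof.
apply: measurable_funB => //; apply: measurable_continuous_comp => // x.
exact/differentiable_continuous/hC1.1.
Qed.

Let err0 k w : 0 <= err k w. Proof. exact: powR_ge0. Qed.
Let grad0 k w : 0 <= grad k w. Proof. exact: enorm_ge0. Qed.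
Let gap0 k w : 0 <= gap k w. Proof. by rewrite subr_ge0. Qed.

Lemma integral_sample k (h : Xi -> \bar R) : measurable_fun setT h ->
  (forall z, 0 <= h z)%E -> (\int[P]_w h (xi k w) = \int[mu]_z h z)%E.
Proof.
move=> mh h0.
rewrite -(ge0_integral_distribution (xi k) mh h0).
by apply: eq_measure_integral => A mA _; exact: law.
Qed.

(** theta_{-1} = 1 makes m^0 a plain stochastic gradient at x0. *)
Lemma mean_error_init : (\int[P]_w (err 0 w)%:E <= (sigma `^ al)%:E)%E.
Proof.
have E w : err 0 w = enorm (G x0 (xi 0%N w) - gradient f x0) `^ al.
  by rewrite /err /M rm_momentumE /= subrr !scale0r add0r subr0.
under eq_integral do rewrite E.
rewrite (@integral_sample 0%N
  (fun z => (enorm (G x0 z - gradient f x0) `^ al)%:E))//; last first.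
  by move=> z; rewrite lee_fin powR_ge0.
apply/measurable_EFinP; apply: measurable_enorm_powR.
apply: vmeasurableB; last exact: vmeasurable_cst.
exact: vmeasurable_estimator.
Qed.

(** The sample xi k.+1 is independent of the state built from the samples before
    it, so it can be integrated first, with that state frozen. *)
Lemma mean_error_step k :
  (\int[P]_w (err k.+1 w)%:E <=
   \int[P]_w ((1 - theta k) * err k w
     + 6 * ((L1 `^ al + L `^ al) * eta k `^ al + sigma `^ al * theta k `^ al))%:E)%E.
Proof.
pose T := g_sigma_algebraType (past xi k.+1).
pose S' (w : T) := rm_state G x0 eta theta (fun j => xi j w) k.+1.
have [vx vy vm] : [/\ vmeasurable (fun w => (S' w).1.1),
    vmeasurable (fun w => (S' w).1.2) & vmeasurable (fun w => (S' w).2)].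
  apply: (vmeasurable_rm_state x0 eta theta mG
    (zeta := fun j (w : T) => xi j w)) => j.
  exact: measurable_past.
pose t := theta k.
pose h (wz : T * Xi) := (enorm ((1 - t) *: (S' wz.1).2 + G (S' wz.1).1.2 wz.2
  - (1 - t) *: G (S' wz.1).1.1 wz.2 - gradient f (S' wz.1).1.2) `^ al)%:E.
have mh : measurable_fun setT h.
  apply/measurable_EFinP; apply: measurable_enorm_powR.
  have vx' := vmeasurable_comp (measurable_fst (T1 := T) (T2 := Xi)) vx.
  have vy' := vmeasurable_comp (measurable_fst (T1 := T) (T2 := Xi)) vy.
  have vm' := vmeasurable_comp (measurable_fst (T1 := T) (T2 := Xi)) vm.
  apply: vmeasurableB.
    apply: vmeasurableB.
      apply: vmeasurableD; first exact: vmeasurableZ.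
      exact: vmeasurable_joint_comp.
    by apply: vmeasurableZ => //; exact: vmeasurable_joint_comp.
  by apply: vmeasurable_continuous_comp => //; exact: hC1.2.
have h0 wz : (0 <= h wz)%E by rewrite lee_fin powR_ge0.
have indS A B : measurable A -> measurable B ->
    P ((idfun : Omega -> T) @^-1` A `&` xi k.+1 @^-1` B)
    = (P ((idfun : Omega -> T) @^-1` A) * mu B)%E.
  move=> mA mB; rewrite preimage_id past_independent//.
  by rewrite -(law k.+1).
rewrite (_ : (\int[P]_w (err k.+1 w)%:E)%E
             = (\int[P]_w h (idfun w, xi k.+1 w))%E); last first.
  by apply: eq_integral => w _; rewrite /h /err /M rm_momentumE.
apply: (indep_integral_le (measurable_id_sub (@past_measurable _ _ _ P _ _ xi k.+1))
  _ indS mh h0) => //.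
  apply/measurable_EFinP; apply: measurable_funD => //.
  exact: measurable_funM.
have SE w : S' w = (X k w, X k w - (eta k / enorm (M k w)) *: M k w, M k w).
  exact: rm_stateS.
move=> w; change (\int[mu]_z (enorm ((1 - t) *: (S' w).2 + G (S' w).1.2 z
  - (1 - t) *: G (S' w).1.1 z - gradient f (S' w).1.2) `^ al)%:E <=
  ((1 - t) * err k w + 6 * ((L1 `^ al + L `^ al) * eta k `^ al
                            + sigma `^ al * t `^ al))%:E)%E.
rewrite !SE /=.
apply: le_trans (momentum_error_step mG al1 al2 L10 lip meanG noise smooth
  _ _ _ (theta0 k) (theta1 k)) _.
rewrite lee_fin; apply: lerD; first exact: lexx.
rewrite ler_pM2l//; apply: lerD; last exact: lexx.
apply: ler_wpM2l; first by rewrite addr_ge0 ?powR_ge0.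
apply: ge0_ler_powR; rewrite ?nnegrE ?enorm_ge0 ?eta0//.
  exact: ltW (lt_trans ltr01 al1).
exact: normalized_step_length.
Qed.

(** Finiteness of the moments is proved along the recursion; from here on they
    are a real sequence a. *)
Lemma mean_error : exists a : nat -> R,
  [/\ forall k, has_mean P (err k) (a k), a 0%N <= sigma `^ al &
   forall k, a k.+1 <= (1 - theta k) * a k
     + 6 * ((L1 `^ al + L `^ al) * eta k `^ al + sigma `^ al * theta k `^ al)].
Proof.
have step k u : has_mean P (err k) u -> (\int[P]_w (err k.+1 w)%:E <=
    ((1 - theta k) * u + 6 * ((L1 `^ al + L `^ al) * eta k `^ al
       + sigma `^ al * theta k `^ al))%:E)%E.
  move=> hu; have [_ <-] := has_meanD (has_meanZ (1 - theta k) hu)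
    (has_mean_cst P (6 * ((L1 `^ al + L `^ al) * eta k `^ al
       + sigma `^ al * theta k `^ al))).
  exact: mean_error_step.
have ex k : exists u, has_mean P (err k) u.
  elim: k => [|k [u hu]].
    by have [u hu _] := has_mean_ge0_le (merr 0%N) (err0 0%N) mean_error_init; exists u.
  by have [v hv _] := has_mean_ge0_le (merr k.+1) (err0 k.+1) (step _ _ hu); exists v.
have [a ha] := choice ex; exists a; split => //.
  by rewrite -lee_fin; have [_ <-] := ha 0%N; exact: mean_error_init.
by move=> k; rewrite -lee_fin; have [_ <-] := ha k.+1; exact: step.
Qed.

Hypothesis eta_gt0 : forall k, 0 < eta k.
(* the split of the linear error term between the potential and a remainder *)
Variables (q c : nat -> R).
Hypothesis young : forall k s, 0 <= s -> 2 * eta k * s <= q k * s `^ al + c k.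

(** The pointwise bound pt has nonnegative terms on its left-hand side, so it also
    shows, step after step, that each of them has a finite mean. *)
Lemma mean_progress (a : nat -> R) : (forall k, has_mean P (err k) (a k)) ->
  exists gr gp : nat -> R,
  [/\ forall k, has_mean P (grad k) (gr k), forall k, 0 <= gp k,
      gp 0%N = f x0 - f_low &
   forall k, gp k.+1 + eta k * gr k
     <= gp k + (q k * a k + (c k + L1 / 2 * eta k ^+ 2))].
Proof.
move=> ha.
pose ub k w := gap k w + (q k * err k w + (c k + L1 / 2 * eta k ^+ 2)).
have pt k w : gap k.+1 w + eta k * grad k w <= ub k w.
  have := normalized_step_descent hC1.1 (X k w) (M k w) lip L10 (eta0 k).
  have := young k (enorm_ge0 (M k w - gradient f (X k w))).
  rewrite /ub /gap /grad /err /X rm_iterateS -/(X k w) -/(M k w).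
  exact: progress_arith.
have hub k u : has_mean P (gap k) u ->
    has_mean P (ub k) (u + (q k * a k + (c k + L1 / 2 * eta k ^+ 2))).
  move=> hu; apply: has_meanD => //; apply: has_meanD; last exact: has_mean_cst.
  exact: has_meanZ.
have egrad0 k w : 0 <= eta k * grad k w by rewrite mulr_ge0.
have gap_init : has_mean P (gap 0%N) (f x0 - f_low).
  by rewrite (_ : gap 0%N = fun=> f x0 - f_low)//; exact: has_mean_cst.
have ex k : exists u, has_mean P (gap k) u.
  elim: k => [|k [u hu]].
    by exists (f x0 - f_low).
  have H := has_mean_ge0_ub (mgap k.+1) (gap0 k.+1) _ (hub _ _ hu).
  have [w|v hv _] := has_mean_ge0_le (mgap k.+1) (gap0 k.+1) (H _).
    by apply: le_trans (pt k w); rewrite lerDl.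
  by exists v.
have [gp hgp] := choice ex.
have exg k : exists u, has_mean P (grad k) u.
  have H := has_mean_ge0_ub (mgrad k) (grad0 k) _ (has_meanZ (eta k)^-1 (hub _ _ (hgp k))).
  have [w|v hv _] := has_mean_ge0_le (mgrad k) (grad0 k) (H _).
    rewrite ler_pdivlMl//; apply: le_trans (pt k w); rewrite lerDr; exact: gap0.
  by exists v.
have [gr hgr] := choice exg.
exists gr, gp; split => //.
- move=> k; rewrite -lee_fin; have [_ <-] := hgp k.
  by apply: integral_ge0 => w _; rewrite lee_fin.
- have [_ e] := hgp 0%N; apply/EFin_inj; rewrite -e.
  by have [_ ->] := gap_init.
- move=> k; rewrite -lee_fin.
  have [_ <-] := has_meanD (hgp k.+1) (has_meanZ (eta k) (hgr k)).
  apply: has_mean_ge0_ub (hub _ _ (hgp k)) => //.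
  + by apply: measurable_funD => //; exact: measurable_funM.
  + by move=> w; rewrite addr_ge0.
Qed.

Variable p : nat -> R.
Hypotheses (p0 : forall k, 0 <= p k)
  (pq : forall k, p k.+1 * (1 - theta k) + q k <= p k).

(** The potential is the mean of gap k + p k * err k; pq makes it decrease up to
    the remainders, and its final value is dropped as nonnegative. *)
Lemma sum_mean_gradient : exists gr : nat -> R,
  (forall k, has_mean P (grad k) (gr k)) /\
  forall K, \sum_(k < K) eta k * gr k <= f x0 - f_low + p 0%N * sigma `^ al
    + \sum_(k < K) (c k + L1 / 2 * eta k ^+ 2 + p k.+1 * (6 *
      ((L1 `^ al + L `^ al) * eta k `^ al + sigma `^ al * theta k `^ al))).
Proof.
have [a [ha a0 aS]] := mean_error.
have [gr [gp [hgr gp0 gpi gpS]]] := mean_progress ha.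
exists gr; split => // K.
have age0 k : 0 <= a k.
  rewrite -lee_fin; have [_ <-] := ha k.
  by apply: integral_ge0 => w _; rewrite lee_fin.
set B := fun k => 6 * ((L1 `^ al + L `^ al) * eta k `^ al + sigma `^ al * theta k `^ al).
suff : \sum_(k < K) eta k * gr k + (gp K + p K * a K) <=
    f x0 - f_low + p 0%N * sigma `^ al
    + \sum_(k < K) (c k + L1 / 2 * eta k ^+ 2 + p k.+1 * B k).
  by apply: le_trans; rewrite lerDl addr_ge0// mulr_ge0.
elim: K => [|K IHK].
  by rewrite !big_ord0 add0r addr0 gpi lerD2l ler_wpM2l.
rewrite !big_ord_recr /=.
have h1 := gpS K; have h2 := ler_wpM2l (p0 K.+1) (aS K).
have h3 := ler_wpM2r (age0 K) (pq K).
exact: telescoping_arith IHK h1 h2 h3.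
Qed.

End expected_progress.

(** * Rates for the step sizes of order k to the power -2/3 *)

Section rates.
Context {R : realType}.
Implicit Types (al x y z M e K : R) (k : nat).

Lemma powRDgt0 x y z : 0 < x -> x `^ (y + z) = x `^ y * x `^ z.
Proof. by move=> x0; rewrite powRD// (gt_eqF x0) implybT. Qed.

(** For k >= 1, (k + 1)^-1 is at most ln (k + 1) - ln k. *)
Lemma harmonic_sum_le (K : nat) : (0 < K)%N ->
  \sum_(k < K) (k.+1%:R^-1 : R) <= 1 + ln K%:R.
Proof.
elim: K => // -[_ _|K IHK _].
  by rewrite big_ord1 ln1 addr0 invr1.
rewrite big_ord_recr /=; apply: le_trans (lerD (IHK isT) (lexx _)) _.
rewrite -addrA lerD2l -lerBrDl.
have K1 : (0 : R) < K.+1%:R by rewrite ltr0n.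
have K2 : (0 : R) < K.+2%:R by rewrite ltr0n.
have := @le_ln1Dx R (- K.+2%:R^-1).
have q x : 0 < x -> 1 - (x + 1)^-1 = x / (x + 1).
  by move=> x0; field; rewrite gt_eqF// ltr_wpDr.
rewrite (_ : 1 + - K.+2%:R^-1 = K.+1%:R / K.+2%:R); last first.
  by rewrite -[K.+2%:R]natr1 q.
rewrite ln_div ?posrE// => h.
have : - 1 < - K.+2%:R^-1 :> R by rewrite ltrN2 invf_lt1// ltr1n.
by move=> /h; rewrite lerNr opprB.
Qed.

(** A negative z, for which z `^ g^-1 is a junk value, satisfies the bound
    trivially. *)
Lemma root_le z K g : 0 < g -> 0 <= K -> z `^ g^-1 <= K -> z <= K `^ g.
Proof.
move=> g0 K0 zK; have [z0|/ltW z0] := leP z 0.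
  exact: le_trans z0 (powR_ge0 _ _).
have := ge0_ler_powR (ltW g0) _ _ zK.
rewrite !nnegrE powR_ge0 => /(_ isT K0).
by rewrite -powRrM mulVf ?gt_eqF// powRr1.
Qed.

Lemma cube_root_le z K : 0 <= K -> z ^+ 3 <= K -> z <= K `^ (1 / 3).
Proof.
move=> K0 zK; have [z0|/ltW z0] := leP z 0.
  exact: le_trans z0 (powR_ge0 _ _).
apply: root_le => //.
by rewrite div1r invrK powR_mulrn.
Qed.

(** ln_le_div for x = K `^ g and y = 2 * M / (g * e), since ln x = g * ln K. *)
Lemma log_rate_le M e g K : 0 < M -> 0 < e -> 0 < g -> 0 < K ->
  (4 * M / (g * e)) * ln (4 * M / (g * e)) <= K `^ g ->
  M * ln K / K `^ g <= e / 2.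
Proof.
move=> M0 e0 g0 K0 h; have u0 : 0 < K `^ g by rewrite powR_gt0.
have y0 : 0 < 2 * M / (g * e) by rewrite divr_gt0 ?mulr_gt0.
have := @ln_le_div R (K `^ g) (2 * M / (g * e)) u0 y0.
rewrite (_ : 2 * (2 * M / (g * e)) = 4 * M / (g * e)); last first.
  by field; rewrite !gt_eqF.
move=> /(_ h); rewrite ln_powR => h'.
rewrite ler_pdivrMr//.
rewrite -(ler_pM2l (divr_gt0 g0 M0)).
rewrite (_ : g / M * (M * ln K) = g * ln K); last by field; rewrite gt_eqF.
apply: le_trans h' _; rewrite le_eqVlt; apply/predU1P; left.
by field; rewrite !gt_eqF.
Qed.

Section step_sizes.
Variable al : R.
Hypotheses (al1 : 1 < al) (al2 : al <= 2).

Let al0 : 0 < al. Proof. exact: lt_trans ltr01 al1. Qed.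

(** The potential weighs the momentum error by (k + 1) `^ weight_exp, the weight
    for which the Young remainder and the weighted noise decay at the same rate
    (k + 1) `^ (- decay_exp). *)
Definition weight_exp : R := 2 * (al - 1) ^+ 2 / (3 * al).
Definition decay_exp : R := (4 * al - 2) / (3 * al).

Lemma weight_exp_gt0 : 0 < weight_exp.
Proof. by rewrite /weight_exp divr_gt0 ?mulr_gt0 ?exprn_gt0 ?subr_gt0. Qed.

Lemma weight_exp_le : weight_exp <= 1 / 3.
Proof.
rewrite /weight_exp ler_pdivrMr ?mulr_gt0//.
have : (al - 1) ^+ 2 <= al - 1.
  by rewrite expr2 ler_piMl ?subr_ge0 ?(ltW al1)// lerBlDr.
by move: al1 al2; lra.
Qed.

Lemma decay_exp_le1 : decay_exp <= 1.
Proof. by rewrite /decay_exp ler_pdivrMr ?mulr_gt0//; move: al2; lra. Qed.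

Let N k : R := k.+1%:R.
Let N0 k : 0 < N k. Proof. by rewrite ltr0n. Qed.
Let N1 k : 1 <= N k. Proof. by rewrite ler1n. Qed.
Let eta k := N k `^ (- (2 / 3)).
Let p k := N k `^ weight_exp.

Lemma eta_bounds k : (N k)^-1 <= eta k /\ eta k <= 1.
Proof.
split.
  rewrite -powR_inv1 ?(ltW (N0 k))//; apply: ler_powR => //; lra.
by rewrite -[leRHS](powRr0 (N k)); apply: ler_powR => //; lra.
Qed.

Lemma sqr_eta_le k : eta k ^+ 2 <= (N k)^-1.
Proof.
rewrite -powR_mulrn ?powR_ge0// /eta -powRrM -[leRHS]powR_inv1 ?(ltW (N0 k))//.
by apply: ler_powR => //; lra.
Qed.

(** Bernoulli's inequality with exponent weight_exp <= 1 / 3. *)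
Lemma weight_growth k : p k.+1 <= p k * (1 + (3 * N k)^-1).
Proof.
have e : N k.+1 = N k * (1 + (N k)^-1).
  by rewrite mulrDr mulr1 divff ?gt_eqF// /N natr1.
have iN : 0 < (N k)^-1 by rewrite invr_gt0.
rewrite /p e powRM ?(ltW (N0 k)) ?addr_ge0 ?(ltW iN)//.
rewrite ler_wpM2l ?powR_ge0//.
have h : weight_exp <= 1 by apply: le_trans weight_exp_le _; lra.
apply: le_trans (bernoulli_powR_le weight_exp_gt0 h _) _.
  by rewrite addr_ge0 ?(ltW iN).
rewrite addrAC subrr add0r lerD2l invfM.
by rewrite ler_wpM2r ?(ltW iN)//; have := weight_exp_le; lra.
Qed.

Lemma weight_le_double k : p k.+1 <= 2 * p k.
Proof.
apply: le_trans (weight_growth k) _; rewrite mulrC ler_wpM2r ?powR_ge0//.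
have : (3 * N k)^-1 <= 1 by rewrite invf_le1 ?mulr_gt0//; have := N1 k; lra.
by move=> h; apply: le_trans (lerD (lexx 1) h) _; lra.
Qed.

(** The growth of p, of relative size (3 * N k)^-1, is beaten by half of
    eta k, which is at least (N k)^-1. *)
Lemma weight_contraction k :
  p k.+1 * (1 - eta k) + p k * eta k / 2 <= p k.
Proof.
have [h1 h2] := eta_bounds k.
have h3 := weight_growth k; have p0 : 0 <= p k by exact: powR_ge0.
have h4 : 0 <= 1 - eta k by rewrite subr_ge0.
apply: le_trans (lerD (ler_wpM2r h4 h3) (lexx _)) _.
have iN : 0 < (N k)^-1 by rewrite invr_gt0.
rewrite invfM -!mulrA -mulrDr ler_piMr//.
move: h1 h2 iN; move: (eta k) (N k)^-1 => e i h1 h2 i0; nra.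
Qed.

(** The scaling by u turns s `^ al / 2 and 2 * s into the two terms of the step at
    the common rate N k `^ (- decay_exp). *)
Lemma young_step C k s : (forall t, 0 <= t -> 2 * t <= t `^ al / 2 + C) ->
  0 <= s -> 2 * eta k * s <= p k * eta k / 2 * s `^ al + C * N k `^ (- decay_exp).
Proof.
move=> hC s0; pose u := N k `^ ((2 / 3) * (al - 1) / al).
have u0 : 0 <= u by exact: powR_ge0.
have := ler_wpM2r (powR_ge0 (N k) (- decay_exp)) (hC (s * u) (mulr_ge0 s0 u0)).
have an0 : al != 0 by rewrite gt_eqF.
have e1 : N k `^ (- decay_exp) * u = eta k.
  rewrite /u -powRDgt0 /eta// /decay_exp; congr (_ `^ _).
  by field.
have e2 : N k `^ (- decay_exp) * u `^ al = p k * eta k.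
  rewrite /u -powRrM -powRDgt0 /eta// /p -powRDgt0// /decay_exp /weight_exp.
  by congr (_ `^ _); field.
rewrite (powRM _ s0 u0) [leRHS]mulrDl.
rewrite (_ : 2 * (s * u) * _ = 2 * (N k `^ (- decay_exp) * u) * s); last ring.
rewrite (_ : s `^ al * u `^ al / 2 * _
  = N k `^ (- decay_exp) * u `^ al / 2 * s `^ al); last ring.
by rewrite e1 e2.
Qed.

(** The exponents of p k and eta k `^ al add up to - decay_exp. *)
Lemma noise_step k : p k.+1 * eta k `^ al <= 2 * N k `^ (- decay_exp).
Proof.
have e : p k * eta k `^ al = N k `^ (- decay_exp).
  rewrite /p /eta -powRrM -powRDgt0// /decay_exp /weight_exp.
  by congr (_ `^ _); field; rewrite gt_eqF.
by rewrite -e mulrA ler_wpM2r ?powR_ge0// weight_le_double.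
Qed.

(** Against (N k)^-1 the sum over k is harmonic whatever al; the price is the
    factor K `^ (1 - decay_exp), where decay_exp <= 1. *)
Lemma decay_le k (K : nat) : (k < K)%N ->
  N k `^ (- decay_exp) <= (N k)^-1 * K%:R `^ (1 - decay_exp).
Proof.
move=> kK; rewrite [in leLHS](_ : - decay_exp = - 1 + (1 - decay_exp)); last by ring.
rewrite powRDgt0// powR_inv1 ?(ltW (N0 k))// ler_wpM2l ?invr_ge0 ?(ltW (N0 k))//.
rewrite ge0_ler_powR ?nnegrE ?ler0n ?ler_nat ?subr_ge0 ?decay_exp_le1//.
Qed.

Lemma sum_remainder_le (L1 H : R) (K : nat) : (0 < K)%N -> 0 <= L1 -> 0 <= H ->
  \sum_(k < K) (L1 / 2 * eta k ^+ 2 + H * N k `^ (- decay_exp))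
    <= (L1 / 2 + H * K%:R `^ (1 - decay_exp)) * (1 + ln K%:R).
Proof.
move=> K0 L0 H0.
have c0 : 0 <= L1 / 2 + H * K%:R `^ (1 - decay_exp).
  by rewrite addr_ge0 ?divr_ge0 ?mulr_ge0 ?powR_ge0.
apply: le_trans (ler_wpM2l c0 (harmonic_sum_le K0)).
rewrite mulr_sumr; apply: ler_sum => k _; rewrite mulrDl; apply: lerD.
  by rewrite ler_wpM2l ?divr_ge0//; exact: sqr_eta_le.
rewrite -mulrA ler_wpM2l// mulrC; exact: decay_le.
Qed.

(** The step sizes decrease, so K `^ (- (2 / 3)) times the plain sum is at most
    the weighted one. *)
Lemma average_le (gr : nat -> R) (K : nat) (A B H : R) : (0 < K)%N ->
  1 <= ln (K%:R : R) -> (forall k, 0 <= gr k) -> 0 <= A -> 0 <= B -> 0 <= H ->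
  \sum_(k < K) eta k * gr k
    <= A + (B + H * K%:R `^ (1 - decay_exp)) * (1 + ln K%:R) ->
  (\sum_(k < K) gr k) / K%:R
    <= 2 * (A + B) * ln K%:R / K%:R `^ (1 / 3)
       + 2 * H * ln K%:R / K%:R `^ (2 * (al - 1) / (3 * al)).
Proof.
move=> K0 lK gr0 A0 B0 H0 hs; have Kp : (0 : R) < K%:R by rewrite ltr0n.
have h1 : K%:R `^ (- (2 / 3)) * \sum_(k < K) gr k <= \sum_(k < K) eta k * gr k.
  rewrite mulr_sumr; apply: ler_sum => k _; rewrite ler_wpM2r// /eta.
  rewrite !powRN lef_pV2 ?posrE ?powR_gt0//.
  by rewrite ge0_ler_powR ?nnegrE ?ler0n// ler_nat.
have {h1 hs} := le_trans h1 hs.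
set W := K%:R `^ (1 - decay_exp); have W0 : 0 <= W by exact: powR_ge0.
have e1 : K%:R^-1 = (K%:R : R) `^ (- (1 / 3)) * K%:R `^ (- (2 / 3)).
  by rewrite -powRDgt0// -powR_inv1 ?(ltW Kp)//; congr (_ `^ _); field.
have e2 : (K%:R `^ (2 * (al - 1) / (3 * al)))^-1 = K%:R `^ (- (1 / 3)) * W :> R.
  rewrite /W -powRDgt0// -powRN /decay_exp; congr (_ `^ _).
  by field; rewrite gt_eqF.
move=> /(ler_wpM2l (powR_ge0 K%:R (- (1 / 3)))).
rewrite mulrA -e1 mulrC => /le_trans; apply.
rewrite e2 -powRN; set Q := K%:R `^ (- (1 / 3)).
move: (ln _) lK => l l1.
rewrite [leRHS](_ : _ = Q * (2 * (A + B) * l + 2 * (H * W) * l)); last by ring.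
rewrite ler_wpM2l ?powR_ge0// mulrDl mulrDr.
have : 0 <= H * W by exact: mulr_ge0.
by move: (H * W) => w w0; nra.
Qed.

End step_sizes.

End rates.

(** * The random output index *)

Section random_index.
Context {R : realType} {dOmega : measure_display} {Omega : measurableType dOmega}
  (P : probability Omega R).
Context {dXi : measure_display} {Xi : measurableType dXi}
  (xi : nat -> {RV P >-> Xi}) (iota : {RV P >-> nat}).

(** Generators of sigma_of_sequence xi. *)
Definition sample_events : set (set Omega) :=
  \bigcup_k preimage_set_system setT (xi k) measurable.

Lemma sample_events_measurable : sample_events `<=` measurable.
Proof. by move=> A [j _ [B mB <-]]; exact: measurable_funPT. Qed.

Lemma measurable_sample j :
  measurable_fun setT (xi j : g_sigma_algebraType sample_events -> Xi).
Proof. by move=> _ A mA; apply: sub_sigma_algebra; exists j => //; exists A. Qed.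

(** The K atoms of mass K^-1 exhaust the total mass 1. *)
Lemma uniform_below_null K : (0 < K)%N -> uniform_below K iota ->
  P (iota @^-1` (~` `I_K)) = 0%E.
Proof.
move=> K0 unif.
have mi A : measurable (iota @^-1` A).
  by rewrite -[X in measurable X]setTI; exact: measurable_funPT.
rewrite preimage_setC (probability_setC P (mi `I_K)).
suff -> : P (iota @^-1` `I_K) = 1%E by rewrite subee.
have -> : iota @^-1` `I_K = \big[setU/set0]_(j < K) (iota @^-1` [set (j : nat)]).
  rewrite -(bigcup_mkord K (fun j => iota @^-1` [set j])).
  by apply/seteqP; split => [w /= h|w [j /= jK ->]//]; exists (iota w).
rewrite (measure_bigsetU P (fun j => mi [set j])); last first.
  by move=> i j _ _ [w [/= <- <-]].
rewrite (eq_bigr (fun=> (K%:R^-1 : R)%:E)); last by move=> j _; exact: unif.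
by rewrite sumEFin sumr_const card_ord -(mulr_natr K%:R^-1) mulVf// pnatr_eq0 -lt0n.
Qed.

(** Almost surely g (iota w) w is the finite sum over k < K of the products
    (iota w == k) * g k w, whose factors are independent. *)
Lemma integral_uniform_index (K : nat) (g : nat -> Omega -> R) (m : nat -> R) :
  (0 < K)%N -> uniform_below K iota -> independent_of_sequence iota xi ->
  (forall k, measurable_fun setT
     (g k : g_sigma_algebraType sample_events -> R)) ->
  (forall k w, 0 <= g k w) -> (forall k, has_mean P (g k) (m k)) ->
  (\int[P]_w (g (iota w) w)%:E = ((\sum_(k < K) m k) / K%:R)%:E)%E.
Proof.
move=> K0 unif ind mg g0 hm.
pose T := g_sigma_algebraType sample_events.
pose h k (wj : T * nat) := ((wj.2 == k)%:R * g k wj.1)%:E.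
have h0 k wj : (0 <= h k wj)%E by rewrite lee_fin mulr_ge0.
have mh k : measurable_fun setT (h k).
  apply/measurable_EFinP; apply: measurable_funM.
    apply: (measurableT_comp (f := fun j : nat => (j == k)%:R : R)) => //.
  exact: (measurableT_comp (mg k)).
have indS A B : measurable A -> measurable B ->
    P ((idfun : Omega -> T) @^-1` A `&` iota @^-1` B)
    = (P ((idfun : Omega -> T) @^-1` A) * distribution P iota B)%E.
  by move=> mA mB; rewrite preimage_id setIC ind// muleC.
have mi A : measurable (iota @^-1` A).
  by rewrite -[X in measurable X]setTI; exact: measurable_funPT.
have E k : (\int[P]_w ((iota w == k)%:R * g k w)%:E
            = P (iota @^-1` [set k]) * (m k)%:E)%E.
  have := indep_integral (measurable_id_sub sample_events_measurable)
    (measurable_funPT iota) indS (mh k) (h0 k).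
  rewrite /h /= => ->.
  have inner w : (\int[distribution P iota]_z ((z == k)%:R * g k w)%:E
      = P (iota @^-1` [set k]) * (g k w)%:E)%E.
    transitivity (\int[distribution P iota]_z
        ((g k w)%:E * (\1_[set k] z)%:E))%E.
      apply: eq_integral => z _; rewrite -EFinM mulrC indicE; congr (_ * _)%:E.
      by congr (nat_of_bool _)%:R; apply/eqP/idP; rewrite inE.
    rewrite ge0_integralZl_EFin//.
    by rewrite integral_indic// setIT muleC.
  under eq_integral do rewrite inner.
  have [ig <-] := hm k; rewrite -(fineK (fin_num_measure P _ (mi [set k]))).
  by rewrite integralZl.
have mF k : measurable_fun setT (fun w => ((iota w == k)%:R * g k w)%:E).
  have mS := measurable_id_sub sample_events_measurable.
  exact: (measurableT_comp (mh k) (measurable_fun_pair mS (measurable_funPT iota))).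
have mG k : measurable_fun setT (g k).
  exact: (measurableT_comp (mg k) (measurable_id_sub sample_events_measurable)).
transitivity (\int[P]_w \sum_(k < K) ((iota w == k)%:R * g k w)%:E)%E.
  apply: ge0_ae_eq_integral => //.
  - apply/measurable_EFinP => _ B mB; rewrite setTI.
    rewrite (_ : _ @^-1` B = \bigcup_k (iota @^-1` [set k] `&` g k @^-1` B)).
      apply: bigcup_measurable => k _; apply: measurableI => //.
      by rewrite -[X in measurable X]setTI; exact: mG.
    apply/seteqP; split => [w /= Bw|w [k _ [/= <-]]//].
    by exists (iota w).
  - by apply: emeasurable_sum => k; exact: mF.
  - by move=> w _; rewrite lee_fin.
  - by move=> w _; apply: sume_ge0 => k _; rewrite lee_fin mulr_ge0.
  - exists (iota @^-1` (~` `I_K)); split => //.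
      exact: uniform_below_null.
    move=> w /= gw wK; apply: gw => _.
    rewrite (bigD1 (Ordinal wK))//= eqxx mul1r big1 ?adde0// => j.
    by move=> /eqP jw; case: eqP => [e|]; [case: jw; apply/val_inj|rewrite mul0r].
rewrite ge0_integral_sum//; last first.
  by move=> k w _; rewrite lee_fin mulr_ge0.
under eq_bigr => k _ do rewrite E.
rewrite mulr_suml -sumEFin; apply: eq_bigr => k _.
have := unif k (ltn_ord k); rewrite /distribution /pushforward => ->.
by rewrite -EFinM mulrC.
Qed.

End random_index.

(** * Complexity of the method *)

Theorem theorem6 (R : realType) (n : nat)
    (f : 'rV[R]_n -> R)
    (hC1 : continuously_differentiable f)
    (hopt : exists xs : 'rV[R]_n, forall x : 'rV[R]_n, f xs <= f x)
    (* the law mu of xi on the sample space Xi, and the estimator G *)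
    (dXi : measure_display) (Xi : measurableType dXi) (mu : probability Xi R)
    (G : 'rV[R]_n -> Xi -> 'rV[R]_n)
    (hG : jointly_measurable G)
    (f_low L1 sigma alpha L : R)
    (hlow : forall x : 'rV[R]_n, f_low <= f x)
    (hL1 : 0 < L1)
    (hLip : forall x y : 'rV[R]_n,
       enorm (gradient f x - gradient f y) <= L1 * enorm (x - y))
    (hsigma : 0 < sigma) (halpha : 1 < alpha <= 2)
    (hmean : forall x : 'rV[R]_n, has_vector_mean mu (G x) (gradient f x))
    (hnoise : forall x : 'rV[R]_n,
       ('E_mu[fun z => (enorm (G x z - gradient f x) `^ alpha)%R]
          <= (sigma `^ alpha)%:E)%E)
    (hL : 0 < L)
    (hsmooth : forall x y : 'rV[R]_n,
       ('E_mu[fun z => (enorm (G x z - G y z) `^ alpha)%R]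
          <= (L `^ alpha * enorm (x - y) `^ alpha)%:E)%E)
    (* independent samples xi^0, xi^1, ... of xi *)
    (dOmega : measure_display) (Omega : measurableType dOmega)
    (P : probability Omega R)
    (xi : nat -> {RV P >-> Xi})
    (hlaw : forall (k : nat) (B : set Xi), measurable B ->
       distribution P (xi k) B = mu B)
    (hindep : mutually_independent xi)
    (x0 : 'rV[R]_n)
    (eta theta : nat -> R)
    (heta : forall k : nat, eta k = 1 / (k.+1%:R `^ (2 / 3)))
    (htheta : forall k : nat, theta k = 1 / (k.+1%:R `^ (2 / 3)))
    (hm : {ae P, forall w : Omega, forall k : nat,
       rm_momentum G x0 eta theta (fun j => xi j w) k != 0})
    (eps : R) (heps : 0 < eps < 1)
    (K : nat)
    (hK : Num.max
            ((12 * M_tilde (f x0) f_low sigma alpha L1 / eps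
               * ln (12 * M_tilde (f x0) f_low sigma alpha L1 / eps)) ^+ 3)
            (Num.max
              ((6 * alpha * M_hat alpha L1 L sigma / ((alpha - 1) * eps)
                 * ln (6 * alpha * M_hat alpha L1 L sigma
                         / ((alpha - 1) * eps)))
               `^ (3 * alpha / (2 * (alpha - 1))))
              3)
          <= K%:R)
    (iotaK : {RV P >-> nat})
    (hunif : uniform_below K iotaK)
    (hiotaK : independent_of_sequence iotaK xi) :
  ('E_P[fun w : Omega =>
      enorm (gradient f
        (rm_iterate G x0 eta theta (fun j => xi j w) (iotaK w)))]
    <= eps%:E)%E.
Proof.
move: halpha => /andP[al1 al2]; move: heps => /andP[e0 e1].
have al0 : 0 < alpha by exact: lt_trans ltr01 al1.
have K3 : (3 : R) <= K%:R by move: hK; rewrite !ge_max => /and3P[].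
have K0 : (0 < K)%N by rewrite -(ltr0n R); exact: lt_le_trans K3.
have Kp : (0 : R) < K%:R by rewrite ltr0n.
have stepE k : 1 / (k.+1%:R `^ (2 / 3)) = k.+1%:R `^ (- (2 / 3)) :> R.
  by rewrite powRN div1r.
have etaE k : eta k = k.+1%:R `^ (- (2 / 3)) by rewrite heta stepE.
have thetaE k : theta k = k.+1%:R `^ (- (2 / 3)) by rewrite htheta stepE.
have eta0 k : 0 < eta k by rewrite etaE powR_gt0// ltr0n.
have theta0 k : 0 <= theta k by rewrite thetaE powR_ge0.
have theta1 k : theta k <= 1 by rewrite thetaE; have [] := @eta_bounds R k.
set C := (2 : R) `^ (alpha - 1)^-1 * (alpha - 1) * (2 / alpha) `^ (alpha / (alpha - 1)).
have am1 : 0 <= alpha - 1 by rewrite subr_ge0 ltW.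
have C0 : 0 <= C by rewrite !mulr_ge0 ?powR_ge0.
set H := C + 12 * (L1 `^ alpha + L `^ alpha) + 12 * sigma `^ alpha.
have H0 : 0 < H.
  rewrite ltr_wpDl// ?mulr_gt0 ?powR_gt0// addr_ge0// mulr_ge0//.
  by rewrite addr_ge0 ?powR_ge0.
have noise x : (\int[mu]_z (enorm (G x z - gradient f x) `^ alpha)%:E
    <= (sigma `^ alpha)%:E)%E by have := hnoise x; rewrite unlock.
have smooth x y : (\int[mu]_z (enorm (G x z - G y z) `^ alpha)%:E
    <= (L `^ alpha * enorm (x - y) `^ alpha)%:E)%E.
  by have := hsmooth x y; rewrite unlock.
pose N k : R := k.+1%:R.
pose p k := N k `^ weight_exp alpha.
have young k s : 0 <= s -> 2 * eta k * s
    <= p k * eta k / 2 * s `^ alpha + C * N k `^ (- decay_exp alpha).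
  move=> s0; rewrite etaE; apply: young_step => // t t0; exact: young_constant.
have contr k : p k.+1 * (1 - theta k) + p k * eta k / 2 <= p k.
  by rewrite thetaE etaE; exact: weight_contraction.
have [gr [hgr hsum]] := sum_mean_gradient hC1 hG al1 al2 (ltW hL1) hlow hLip hmean
  noise smooth hlaw hindep x0 (fun k => ltW (eta0 k)) theta0 theta1 eta0 young
  (fun k => powR_ge0 _ _) contr.
have gr0 k : 0 <= gr k.
  rewrite -lee_fin; have [_ <-] := hgr k.
  by apply: integral_ge0 => w _; rewrite lee_fin enorm_ge0.
rewrite unlock (integral_uniform_index (g := fun k w => enorm (gradient f
  (rm_iterate G x0 eta theta (fun j => xi j w) k))) K0 hunif hiotaK _ _ hgr);
  last 2 first.
- move=> k; apply: measurable_enorm; apply: vmeasurable_continuous_comp.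
    exact: hC1.2.
  by have [] := vmeasurable_rm_state x0 eta theta hG (zeta := fun j
    (w : g_sigma_algebraType (sample_events xi)) => xi j w) (k := k)
    (fun j _ => measurable_sample j).
- by move=> k w; exact: enorm_ge0.
rewrite lee_fin; set gap := f x0 - f_low.
have gap0 : 0 <= gap by rewrite subr_ge0.
have s0 : 0 <= sigma `^ alpha by exact: powR_ge0.
have A0 : 0 <= gap + sigma `^ alpha by rewrite addr_ge0.
have B0 : 0 < L1 / 2 by rewrite divr_gt0.
have total : \sum_(k < K) k.+1%:R `^ (- (2 / 3)) * gr k <= gap + sigma `^ alpha
    + (L1 / 2 + H * K%:R `^ (1 - decay_exp alpha)) * (1 + ln K%:R).
  rewrite (eq_bigr (fun k : 'I_K => eta k * gr k)); last by move=> k _; rewrite etaE.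
  apply: le_trans (hsum K) _; apply: lerD.
    by rewrite /p powR1 mul1r.
  apply: le_trans (sum_remainder_le al1 al2 K0 (ltW hL1) (ltW H0)).
  apply: ler_sum => k _.
  rewrite thetaE etaE; apply: remainder_arith; [by rewrite addr_ge0 ?powR_ge0| |].
    exact: powR_ge0.
  exact: noise_step.
have avg := average_le al1 K0 (ln_ge1 K3) gr0 A0 (ltW B0) (ltW H0) total.
apply: le_trans avg _.
have M1 : M_tilde (f x0) f_low sigma alpha L1 = 2 * (gap + sigma `^ alpha + L1 / 2) by [].
have M2 : M_hat alpha L1 L sigma = 2 * H by [].
move: hK; rewrite M1 M2 !ge_max => /and3P[h1 h2 _].
rewrite [leRHS](_ : eps = eps / 2 + eps / 2); last by field.
apply: lerD.
  apply: log_rate_le => //.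
  - by rewrite mulr_gt0// ltr_wpDl.
  - rewrite (_ : 4 * _ / _ = 12 * (2 * (gap + sigma `^ alpha + L1 / 2)) / eps).
      exact: cube_root_le.
    by field; rewrite gt_eqF.
apply: log_rate_le => //.
- by rewrite mulr_gt0.
- by rewrite divr_gt0 ?mulr_gt0 ?subr_gt0.
- rewrite (_ : 4 * _ / _ = 6 * alpha * (2 * H) / ((alpha - 1) * eps)).
    apply: root_le => //; first by rewrite divr_gt0 ?mulr_gt0 ?subr_gt0.
    by rewrite invf_div.
  by field; rewrite !gt_eqF ?subr_gt0.
Qed.
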